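(* Let $\eta_0>0$, $\xi>0$, $\eta_1>-2$. In the limit $k_c\to\infty$ the covariance function of the three-dimensional FGC-SSRF is, for $r=|\mathbf{r}|>0$ and $h=r/\xi$, $$G(r)=\frac{\eta_0}{2\pi}\,W_3(h,\eta_1),$$ where $$W_3(h,\eta_1)=\begin{cases}\dfrac{e^{-h\beta_2}}{\Delta}\left[\dfrac{\sin(h\beta_1)}{h}\right], & |\eta_1|<2,\\[3mm] \dfrac14\,e^{-h}, & \eta_1=2,\\[3mm] \dfrac{1}{2\Delta}\left(\dfrac{e^{-h\omega_1}-e^{-h\omega_2}}{h}\right), & \eta_1>2.\end{cases}$$
   Context: The three-dimensional FGC-SSRF with parameters $(\eta_0,\eta_1,\xi,k_c)$ is the stationary, isotropic, zero-mean Gaussian random field on $\mathbb{R}^3$ with covariance function $$G_{k_c}(\mathbf{r})=\frac{1}{(2\pi)^3}\int_{|\mathbf{k}|\le k_c}e^{i\mathbf{k}\cdot\mathbf{r}}\,\frac{\eta_0\,\xi^3}{1+\eta_1(|\mathbf{k}|\xi)^2+(|\mathbf{k}|\xi)^4}\,d\mathbf{k}=\frac{\eta_0\,\xi}{2\pi^2\,r}\int_0^{k_c\xi}\frac{u\,\sin(ru/\xi)}{1+\eta_1u^2+u^4}\,du,$$ with $r=|\mathbf{r}|>0$ in the last expression. Its infinite-band limit is $G(r)=\lim_{k_c\to\infty}G_{k_c}(\mathbf{r})$. Notation: $\Delta=|\eta_1^2-4|^{1/2}$; $\beta_1=\frac{|2-\eta_1|^{1/2}}{2}$, $\beta_2=\frac{|2+\eta_1|^{1/2}}{2}$;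 $\omega_1=\left(\frac{|\eta_1-\Delta|}{2}\right)^{1/2}$, $\omega_2=\left(\frac{|\eta_1+\Delta|}{2}\right)^{1/2}$. *)

(* Defs.v *)
From HB Require Import structures.
From mathcomp Require Import all_boot all_order all_algebra.
From mathcomp Require Import complex.
From mathcomp Require Import all_classical all_reals all_analysis.
Set Implicit Arguments.
Unset Strict Implicit.
Unset Printing Implicit Defensive.
Import Order.TTheory GRing.Theory Num.Theory numFieldNormedType.Exports.
Local Open Scope classical_set_scope.
Local Open Scope ring_scope.
Local Open Scope complex_scope.

(* The library's norm on products is the sup norm, hence the explicit
   Euclidean norm on R^3 = R * R * R. *)
Definition dot3 (R : realType) (k r : R * R * R) : R :=
  k.1.1 * r.1.1 + k.1.2 * r.1.2 + k.2 * r.2.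

Definition norm3 (R : realType) (r : R * R * R) : R := Num.sqrt (dot3 r r).

Definition lebesgue3 (R : realType) :=
  ((@lebesgue_measure R \x @lebesgue_measure R) \x @lebesgue_measure R)%E.

Definition Cintegral d (T : measurableType d) (R : realType)
    (mu : {measure set T -> \bar R}) (D : set T) (f : T -> R[i]) : R[i] :=
  Rintegral mu D (fun x => complex.Re (f x)) +i*
  Rintegral mu D (fun x => complex.Im (f x)).

(* e^{i x} for real x *)
Definition cexpi (R : realType) (x : R) : R[i] := cos x +i* sin x.

Definition spectral_density (R : realType) (eta0 eta1 xi : R)
    (k : R * R * R) : R :=
  eta0 * xi ^+ 3 /
  (1 + eta1 * (norm3 k * xi) ^+ 2 + (norm3 k * xi) ^+ 4).

(* G_{kc}(r), the inverse Fourier transform of the band-limited density *)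
Definition fgc_covariance (R : realType) (eta0 eta1 xi kc : R)
    (r : R * R * R) : R[i] :=
  (((2 * pi) ^+ 3)^-1)%:C *
  Cintegral (@lebesgue3 R) [set k | norm3 k <= kc]
    (fun k => cexpi (dot3 k r) * (spectral_density eta0 eta1 xi k)%:C).

(* [normal_prob m 0] is not the Dirac mass at m in the library, hence the
   separate degenerate case. *)
Definition gaussian_variable d (T : measurableType d) (R : realType)
    (P : probability T R) (Y : T -> R) : Prop :=
  (exists m s : R, s != 0 /\
    forall A : set R, measurable A -> pushforward P Y A = normal_prob m s A) \/
  (exists m : R,
    forall A : set R, measurable A -> pushforward P Y A = dirac m A).

Definition gaussian_field d (T : measurableType d) (R : realType)
    (P : probability T R) (X : R * R * R -> {RV P >-> R}) : Prop :=
  forall (n : nat) (s : 'I_n -> R * R * R) (a : 'I_n -> R),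
    gaussian_variable P (fun w => \sum_(i < n) a i * X (s i) w).

(* For Gaussian fields the second-order notions of stationarity and isotropy
   coincide with the invariance of the finite-dimensional laws. *)
Definition stationary_field d (T : measurableType d) (R : realType)
    (P : probability T R) (X : R * R * R -> {RV P >-> R}) : Prop :=
  (forall s t, 'E_P[X s] = 'E_P[X t])%E /\
  forall s t v, covariance P (X (s + v)) (X (t + v)) = covariance P (X s) (X t).

Definition isotropic_field d (T : measurableType d) (R : realType)
    (P : probability T R) (X : R * R * R -> {RV P >-> R}) : Prop :=
  forall s t s' t', norm3 (s - t) = norm3 (s' - t') ->
    covariance P (X s) (X t) = covariance P (X s') (X t').

Definition zero_mean_field d (T : measurableType d) (R : realType)
    (P : probability T R) (X : R * R * R -> {RV P >-> R}) : Prop :=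
  forall s, ('E_P[X s] = 0)%E.

Definition has_covariance_function d (T : measurableType d) (R : realType)
    (P : probability T R) (X : R * R * R -> {RV P >-> R})
    (G : R * R * R -> R[i]) : Prop :=
  forall s t, covariance P (X s) (X t) \is a fin_num /\
    (fine (covariance P (X s) (X t)))%:C = G (s - t).

Definition fgc_ssrf d (T : measurableType d) (R : realType)
    (P : probability T R) (eta0 eta1 xi kc : R)
    (X : R * R * R -> {RV P >-> R}) : Prop :=
  [/\ gaussian_field X, stationary_field X, isotropic_field X,
      zero_mean_field X &
      has_covariance_function X (fgc_covariance eta0 eta1 xi kc)].

Definition ssrf_Delta (R : realType) (eta1 : R) : R :=
  Num.sqrt `|eta1 ^+ 2 - 4|.

Definition ssrf_beta1 (R : realType) (eta1 : R) : R :=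
  Num.sqrt `|2 - eta1| / 2.

Definition ssrf_beta2 (R : realType) (eta1 : R) : R :=
  Num.sqrt `|2 + eta1| / 2.

Definition ssrf_omega1 (R : realType) (eta1 : R) : R :=
  Num.sqrt (`|eta1 - ssrf_Delta eta1| / 2).

Definition ssrf_omega2 (R : realType) (eta1 : R) : R :=
  Num.sqrt (`|eta1 + ssrf_Delta eta1| / 2).

(* Meant for -2 < eta1, where the last branch is 2 < eta1. *)
Definition W3 (R : realType) (h eta1 : R) : R :=
  if `|eta1| < 2 then
    expR (- (h * ssrf_beta2 eta1)) / ssrf_Delta eta1 *
    (sin (h * ssrf_beta1 eta1) / h)
  else if eta1 == 2 then 4^-1 * expR (- h)
  else (2 * ssrf_Delta eta1)^-1 *
    ((expR (- (h * ssrf_omega1 eta1)) - expR (- (h * ssrf_omega2 eta1))) / h).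

(* Main.v *)
(* The density is integrable over R^3, so the band limit is removed by dominated
   convergence. A rotation written as linear substitutions in one variable at a
   time sends [r] to a coordinate axis, and spherical coordinates turn the
   Fourier integral into [const * \int v * sin (h * v) / (1 + eta1 v^2 + v^4)].
   The function [psi h = 2 * h * W3 h eta1] has [v / (1 + eta1 v^2 + v^4)] as
   sine transform, so the radial integral follows from Fourier inversion, proved
   by Abel summation. Since Tonelli's theorem and the changes of variables are
   used for nonnegative functions, [cos] and [sin] are integrated through
   [1 + cos] and [1 + sin]. *)
Require Import Defs.
From HB Require Import structures.
From mathcomp Require Import all_boot all_order all_algebra.
From mathcomp Require Import complex.
From mathcomp Require Import all_classical all_reals all_analysis.
From mathcomp Require Import measurable_realfun ring lra.
Set Implicit Arguments.
Unset Strict Implicit.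
Unset Printing Implicit Defensive.
Import Order.TTheory GRing.Theory Num.Theory numFieldNormedType.Exports.
Local Open Scope classical_set_scope.
Local Open Scope ring_scope.
Local Open Scope complex_scope.

(** * Affine changes of variable *)

(** The radial integrand, a rational function times a sine, has no elementary primitive, whereas the
    sine transforms of exponentials and damped sines are computed from explicit primitives: hence
    the detour by inversion. The functions to transform are read off the factorisation of
    [1 + eta1 * u ^+ 2 + u ^+ 4], whose roots are $\pm\beta_1\pm i\beta_2$ for $|\eta_1|<2$, the
    double roots $\pm i$ for $\eta_1=2$, and $\pm i\omega_1,\pm i\omega_2$ for $\eta_1>2$. The
    condition [-2 < eta1] bounds this quartic below by a multiple of $1+u^4$. Both $v^2$ and $v$
    divided by it are then integrable: the former gives integrability of the density over space, the
    latter is what inversion asks of the transform. Polar coordinates use the slope [s] of a line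
    through the origin and a signed position [w] on it, not an angle and a positive radius. The
    substitutions [y = x * s] and [x = w * cosatan s] each rescale one real variable while the other
    is frozen, so no Jacobian in several variables occurs. *)

(* Typed on [measurableTypeR R], the domain of [lebesgue_measure], so that its
   pushforward can be formed. *)
Definition affine_fun (R : realType) (a b : R)
  (x : measurableTypeR R) : measurableTypeR R := a * x + b.

Lemma measurable_affine_fun (R : realType) (a b : R) :
  measurable_fun [set: measurableTypeR R] (affine_fun a b).
Proof. by apply: measurable_funD => //; apply: measurable_funM. Qed.

(** The scaled pushforward gives every half-open interval its length, so uniqueness of Lebesgue
    measure identifies the two. *)
Lemma lebesgue_measure_affine (R : realType) (a b : R) (a0 : 0 < a) (A : set R) :
  measurable A ->
  (lebesgue_measure A = a%:E * lebesgue_measure (affine_fun a b @^-1` A))%E.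
Proof.
move=> mA.
pose nu : {measure set (measurableTypeR R) -> \bar R} :=
  mscale (NngNum (ltW a0)) (pushforward (@lebesgue_measure R) (affine_fun a b)).
have -> : lebesgue_measure A = nu (measurable_affine_fun a b) A.
  apply: (lebesgue_measure_unique (mu := nu (measurable_affine_fun a b))) => // _ [[c d]] _ <-.
  change (lebesgue_measure `]c, d] = a%:E * lebesgue_measure (affine_fun a b @^-1` `]c, d]))%E.
  have -> : affine_fun a b @^-1` `]c, d] = `](c - b) / a, (d - b) / a]%classic.
    apply/seteqP; split => x; rewrite /= !in_itv /= ltr_pdivrMr// ler_pdivlMr//.
      by rewrite ltrBlDr lerBrDr mulrC.
    by rewrite ltrBlDr lerBrDr mulrC.
  rewrite !lebesgue_measure_itv /= !lte_fin ltr_pM2r ?invr_gt0// ltrD2r.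
  case: ifPn => _; last by rewrite mule0.
  by rewrite -!EFinD -EFinM; congr (_%:E); field; rewrite gt_eqF.
by [].
Qed.

Lemma ge0_integral_affine (R : realType) (a b : R) (f : R -> \bar R) :
  a != 0 -> measurable_fun [set: R] f -> (forall x, 0 <= f x)%E ->
  (\int[lebesgue_measure]_x f x =
   `|a|%:E * \int[lebesgue_measure]_x f (a * x + b)%R)%E.
Proof.
wlog a0 : a b f / 0 < a => [wlg|_ mf f0].
  rewrite neq_lt => /orP[an0|a0] mf f0; last exact: (wlg _ _ _ a0 (lt0r_neq0 a0)).
  (* A negative [a] is reduced to [- a] by the reflection, which preserves Lebesgue measure. *)
  have mN : measurable_fun [set: R] (-%R : measurableTypeR R -> measurableTypeR R).
    exact: oppr_measurable.
  transitivity (\int[lebesgue_measure]_x f (- x)%R)%E.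
    transitivity (\int[pushforward lebesgue_measure (-%R : measurableTypeR R -> measurableTypeR R)]_x f x)%E.
      by apply: eq_measure_integral => A mA _; exact/esym/lebesgue_measureN.
    by rewrite ge0_integral_pushforward.
  rewrite (wlg (- a) (- b) (fun x => f (- x))) ?oppr_gt0 ?normrN ?oppr_eq0 ?lt_eqF//.
    by congr (_ * _)%E; apply: eq_integral => x _; congr f; ring.
  exact: measurableT_comp.
pose nu : {measure set (measurableTypeR R) -> \bar R} :=
  pushforward (@lebesgue_measure R) (affine_fun a b).
transitivity (\int[mscale (NngNum (ltW a0)) (nu (measurable_affine_fun a b))]_x f x)%E.
  apply: eq_measure_integral => A mA _; exact: lebesgue_measure_affine.
rewrite ge0_integral_mscale//= ge0_integral_pushforward//=; last exact: measurable_affine_fun.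
by rewrite gtr0_norm.
Qed.

(** This is $(1+s^2)^{-1/2}$: the point at signed position [w] on the line of slope [s] is
    [(w * cosatan s, w * cosatan s * s)]. *)
Definition cosatan (R : realType) (s : R) : R := cos (atan s).

Lemma cosatan_gt0 (R : realType) (s : R) : 0 < cosatan s.
Proof. by rewrite /cosatan cos_atan invr_gt0 sqrtr_gt0 ltr_pwDl// sqr_ge0. Qed.

Lemma cosatan_sqr (R : realType) (s : R) : cosatan s ^+ 2 = (1 + s ^+ 2)^-1.
Proof. by rewrite /cosatan cos_atan exprVn sqr_sqrtr// addr_ge0// sqr_ge0. Qed.

Lemma continuous_cosatan (R : realType) : continuous (@cosatan R).
Proof.
move=> s; apply: continuous_comp; first exact: continuous_atan.
exact: continuous_cos.
Qed.

Lemma measurable_cosatan (R : realType) : measurable_fun [set: R] (@cosatan R).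
Proof. by apply: continuous_measurable_fun; exact: continuous_cosatan. Qed.

Ltac measurability := repeat first
  [ assumption | exact: measurable_id | exact: measurable_cst
  | exact: measurable_fst | exact: measurable_snd | exact: measurable_cosatan | exact: normr_measurable
  | match goal with
    | |- measurable_fun _ (fun _ => (_, _)) => apply: measurable_fun_pair
    | |- measurable_fun _ (fun _ => (_ * _)%E) => apply: emeasurable_funM
    | |- measurable_fun _ (fun _ => (_)%:E) => apply/measurable_EFinP
    | |- measurable_fun _ (fun _ => _ + _) => apply: measurable_funD
    | |- measurable_fun _ (fun _ => _ - _) => apply: measurable_funB
    | |- measurable_fun _ (fun _ => _ * _) => apply: measurable_funM
    | |- measurable_fun _ (fun _ => _ ^+ _) => apply: measurable_funX
    | |- measurable_fun _ (fun _ => `|_|) => apply: measurableT_comp; first exact: normr_measurable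
    | |- measurable_fun _ (fun _ => cosatan _) => apply: measurableT_comp; first exact: measurable_cosatan
    | |- measurable_fun _ (fun _ => - _) => apply: measurableT_comp; first exact: oppr_measurable
    | |- measurable_fun _ (fun _ => expR _) => apply: measurableT_comp; first exact: measurable_expR
    | |- measurable_fun _ (fun _ => cos _) => apply: measurableT_comp; first (apply: continuous_measurable_fun; exact: continuous_cos)
    | |- measurable_fun _ (fun _ => sin _) => apply: measurableT_comp; first (apply: continuous_measurable_fun; exact: continuous_sin)
    | H : measurable_fun _ ?f |- measurable_fun _ (fun _ => ?f _) => apply: (measurableT_comp H)
    | |- measurable_fun _ (fun x => fst x) => exact: measurable_fst
    | |- measurable_fun _ (fun x => snd x) => exact: measurable_snd
    | |- measurable_fun _ (fun x => fst _) => apply: (measurableT_comp measurable_fst)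
    | |- measurable_fun _ (fun x => snd _) => apply: (measurableT_comp measurable_snd)
    end ].

(** For [x] fixed, [y = x * s] has Jacobian [|x|]; after exchanging the integrals,
    [x = w * cosatan s] contributes one factor [cosatan s] and turns [|x|] into [|w| * cosatan s].
    Since [w] is signed, the slopes [s] describe every line through the origin but the vertical
    one. *)
Lemma ge0_integral_polar (R : realType) (H : R * R -> \bar R) :
  measurable_fun setT H -> (forall z, 0 <= H z)%E ->
  (\int[lebesgue_measure]_x \int[lebesgue_measure]_y H (x, y) =
   \int[lebesgue_measure]_s \int[lebesgue_measure]_w
     ((`|w| * cosatan s ^+ 2)%:E * H (w * cosatan s, w * cosatan s * s)%R))%E.
Proof.
move=> mH H0.
pose K (z : R * R) : \bar R := (`|z.1|%:E * H (z.1, z.1 * z.2)%R)%E.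
have mK : measurable_fun setT K by rewrite /K; measurability.
have K0 z : (0 <= K z)%E by rewrite mule_ge0.
transitivity (\int[lebesgue_measure]_x \int[lebesgue_measure]_s K (x, s))%E.
  have m1 : measurable_fun setT (fun x => \int[lebesgue_measure]_y H (x, y))%E.
    exact: (measurable_fun_fubini_tonelli_F (m2 := @lebesgue_measure R) H mH H0).
  have m2 : measurable_fun setT (fun x => \int[lebesgue_measure]_y K (x, y))%E.
    exact: (measurable_fun_fubini_tonelli_F (m2 := @lebesgue_measure R) K mK K0).
  (* The substitution degenerates at [x = 0], a null set that is removed from both sides. *)
  have mT0 : measurable (setT `\ (0 : R)) by exact: measurableD.
  rewrite -(integral_setD1 mT0); last exact: measurable_funTS.
  rewrite -[RHS](integral_setD1 mT0); last exact: measurable_funTS.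
  apply: eq_integral => x; rewrite inE => -[_ /= /eqP x0].
  rewrite (@ge0_integral_affine _ x 0 (fun y => H (x, y)) x0)//; last by measurability.
  rewrite /K /= ge0_integralZl//=; last by measurability.
  by congr (_ * _)%E; apply: eq_integral => y _; rewrite addr0.
rewrite (@fubini_tonelli _ _ _ _ _ lebesgue_measure lebesgue_measure K mK K0); apply: eq_integral => s _.
rewrite (@ge0_integral_affine _ (cosatan s) 0 (fun x => K (x, s))) ?gt_eqF ?cosatan_gt0//; last by measurability.
rewrite -ge0_integralZl//=; last by measurability.
apply: eq_integral => w _; rewrite addr0 /K /= muleA -EFinM.
rewrite (mulrC (cosatan s)); congr (_%:E * _)%E.
by rewrite normrM (gtr0_norm (cosatan_gt0 s)); ring.
Qed.

(** * Spherical coordinates *)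

Lemma ge0_integral_swap (R : realType) (K : R * R -> \bar R) :
  measurable_fun setT K -> (forall z, 0 <= K z)%E ->
  (\int[lebesgue_measure]_x \int[lebesgue_measure]_y K (x, y) =
   \int[lebesgue_measure]_y \int[lebesgue_measure]_x K (x, y))%E.
Proof. by move=> mK K0; exact: (@fubini_tonelli _ _ _ _ _ lebesgue_measure lebesgue_measure K). Qed.

(** A planar rotation splits into two shears with scaling. Each side is brought to the same integral
    [K] by an affine substitution in one variable, and both substitutions have the Jacobian
    [|rho / p|]. Dividing by [p] is why [p = 0] is treated apart, by exchanging [x] and [y]. *)
Lemma ge0_integral_rotation (R : realType) (p q : R) (H : R * R -> \bar R) :
  measurable_fun setT H -> (forall z, 0 <= H z)%E ->
  (\int[lebesgue_measure]_x \int[lebesgue_measure]_y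
     H (p * x + q * y, x ^+ 2 + y ^+ 2)%R =
   \int[lebesgue_measure]_x \int[lebesgue_measure]_y
     H (Num.sqrt (p ^+ 2 + q ^+ 2) * x, x ^+ 2 + y ^+ 2)%R)%E.
Proof.
move=> mH H0; wlog p0 : p q / p != 0 => [wlg|].
  have [p0|] := eqVneq p 0; last exact: wlg.
  have [q0|q0] := eqVneq q 0.
    rewrite p0 q0 expr0n/= addr0 sqrtr0.
    by apply: eq_integral => x _; apply: eq_integral => y _; rewrite !mul0r addr0.
  rewrite (@ge0_integral_swap _ (fun z => H (p * z.1 + q * z.2, z.1 ^+ 2 + z.2 ^+ 2))); last 2 first.
  - by measurability.
  - by move=> z; exact: H0.
  rewrite addrC -(wlg _ p q0).
  apply: eq_integral => x _; apply: eq_integral => y _; congr H.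
  by rewrite addrC (addrC (y ^+ 2)).
set rho := Num.sqrt _.
have rho2 : rho ^+ 2 = p ^+ 2 + q ^+ 2 by rewrite sqr_sqrtr// addr_ge0// sqr_ge0.
have rho0 : rho != 0.
  rewrite sqrtr_eq0 -ltNge ltr_wpDr ?sqr_ge0// lt_neqAle sqr_ge0 andbT.
  by rewrite eq_sym sqrf_eq0.
have rp0 : rho / p != 0 by rewrite mulf_neq0// invr_eq0.
(* On the left, [p * x + q * y = rho * u] defines the new variable [u] in place of [x]; since
   [rho ^+ 2 = p ^+ 2 + q ^+ 2], the squared norm becomes $u^2+((\rho y-qu)/p)^2$. On the right,
   that second square is the new [y ^+ 2]. *)
pose K (z : R * R) := H (rho * z.1, z.1 ^+ 2 + (rho / p * z.2 + - (q / p) * z.1) ^+ 2).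
have mK : measurable_fun setT K by rewrite /K; measurability.
have K0 z : (0 <= K z)%E by exact: H0.
transitivity (`|rho / p|%:E * \int[lebesgue_measure]_u \int[lebesgue_measure]_v K (u, v))%E.
  rewrite (@ge0_integral_swap _ (fun z => H (p * z.1 + q * z.2, z.1 ^+ 2 + z.2 ^+ 2))); last 2 first.
  - by measurability.
  - by move=> z; exact: H0.
  rewrite (ge0_integral_swap mK K0).
  rewrite -ge0_integralZl//=; last first.
  - by move=> y _; apply: integral_ge0 => *; exact: H0.
  - exact: (measurable_fun_fubini_tonelli_G (m1 := @lebesgue_measure R) K mK (fun z => H0 _)).
  apply: eq_integral => y _.
  rewrite (@ge0_integral_affine _ (rho / p) (- (q / p) * y))//; last by measurability.
  congr (_ * _)%E; apply: eq_integral => x _; rewrite /K/=; congr (H (_, _)); first by field.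
  apply: (mulfI (x := p ^+ 2)); first by rewrite sqrf_eq0.
  transitivity (rho ^+ 2 * x ^+ 2 - 2 * rho * q * x * y + (p ^+ 2 + q ^+ 2) * y ^+ 2); first by field.
  by rewrite -rho2; transitivity ((p ^+ 2 + q ^+ 2) * x ^+ 2 - 2 * rho * q * x * y + rho ^+ 2 * y ^+ 2); [rewrite -rho2; ring | field].
rewrite -ge0_integralZl//=; last first.
- by move=> y _; apply: integral_ge0 => *; exact: H0.
- exact: (measurable_fun_fubini_tonelli_F (m2 := @lebesgue_measure R) K mK (fun z => H0 _)).
apply: eq_integral => x _.
rewrite [RHS](@ge0_integral_affine _ (rho / p) (- (q / p) * x))//; by measurability.
Qed.

Lemma integral_cosatan_sqr (R : realType) :
  (\int[@lebesgue_measure R]_s (cosatan s ^+ 2)%:E = pi%:E)%E.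
Proof.
rewrite ge0_symfun_integralT; last 3 first.
- by move=> s; exact: sqr_ge0.
- move=> s; apply: (@continuous_comp _ _ _ (@cosatan R) (fun x => x ^+ 2)).
    exact: continuous_cosatan.
  exact: exprn_continuous.
- by move=> s /=; rewrite /cosatan atanN cosN.
rewrite -set_itvcy.
have -> : (\int[lebesgue_measure]_(s in `[0%R, +oo[) (cosatan s ^+ 2)%:E =
  \int[lebesgue_measure]_(s in `[0%R, +oo[) ((@oneDsqr R s)^-1)%:E)%E.
  by apply: eq_integral => s _; rewrite cosatan_sqr.
by rewrite integral0y_oneDsqr -EFinM; congr (_%:E); field.
Qed.

(** A name for the plane measure, to carry the sigma-finiteness that Tonelli's theorem needs for the
    first factor of [lebesgue3]. *)
Definition lebesgue2 (R : realType) :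
    set (measurableTypeR R * measurableTypeR R)%type -> \bar R :=
  (@lebesgue_measure R \x @lebesgue_measure R)%E.

HB.instance Definition _ (R : realType) := Measure.on (@lebesgue2 R).

(** The squares of an increasing exhaustion of the line by sets of finite measure exhaust the plane;
    monotonicity puts both coordinates in one common set. *)
Lemma lebesgue2_sigma_finite (R : realType) : sigma_finite setT (@lebesgue2 R).
Proof.
have /sigma_finiteP[F [TF ndF Foo]] := sigma_finiteT (@lebesgue_measure R).
exists (fun n => F n `*` F n).
  rewrite -setXTT TF predeqE => -[x y]; split.
    move=> [/= [n _ Fnx] [k _ Fky]]; exists (maxn n k) => //; split.
    - by move: x Fnx; exact/subsetPset/ndF/leq_maxl.
    - by move: y Fky; exact/subsetPset/ndF/leq_maxr.
  by move=> [n _ []/= ? ?]; split; exists n.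
move=> k; have [? ?] := Foo k.
split; first exact: measurableX.
by rewrite /lebesgue2 product_measure1E// lte_mul_pinfty// ge0_fin_numE.
Qed.

HB.instance Definition _ (R : realType) :=
  Measure_isSigmaFinite.Build _ _ _ (@lebesgue2 R) (@lebesgue2_sigma_finite R).

Lemma ge0_integral_lebesgue3 (R : realType) (f : R * R * R -> \bar R) :
  measurable_fun setT f -> (forall k, 0 <= f k)%E ->
  (\int[@lebesgue3 R]_k f k =
   \int[lebesgue_measure]_z \int[lebesgue_measure]_x \int[lebesgue_measure]_y f (x, y, z))%E.
Proof.
move=> mf f0; rewrite /lebesgue3.
transitivity (\int[lebesgue_measure]_z \int[@lebesgue2 R]_w f (w, z))%E.
  exact: (@fubini_tonelli2 _ _ _ _ _ (@lebesgue2 R) (@lebesgue_measure R) f mf f0).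
apply: eq_integral => z _; 
by rewrite (@fubini_tonelli1 _ _ _ _ _ lebesgue_measure lebesgue_measure (fun w => f (w, z)))//; measurability.
Qed.

(** Two planar rotations suffice: one in the first two coordinates replaces [(p, q)] by [(rho, 0)],
    the other acts on the new first coordinate and the third and replaces [(rho, t)] by
    [(norm3 r, 0)]. *)
Lemma ge0_integral_lebesgue3_axis (R : realType) (r : R * R * R) (H : R * R -> \bar R) :
  measurable_fun setT H -> (forall z, 0 <= H z)%E ->
  (\int[@lebesgue3 R]_k H (dot3 k r, dot3 k k) =
   \int[lebesgue_measure]_x \int[lebesgue_measure]_y \int[lebesgue_measure]_z
     H (norm3 r * x, x ^+ 2 + (y ^+ 2 + z ^+ 2))%R)%E.
Proof.
move=> mH H0; case: r => -[p q] t.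
rewrite (@ge0_integral_lebesgue3 _ (fun k => H (dot3 k (p, q, t), dot3 k k))); last 2 first.
- by rewrite /dot3; measurability.
- by move=> k; exact: H0.
pose rho := Num.sqrt (p ^+ 2 + q ^+ 2).
(* The arguments are ordered [(y, x, z)]: [y] is already orthogonal to [r] and takes no part in the
   second rotation. *)
pose K (w : R * R * R) := H (rho * w.1.2 + t * w.2, w.1.2 ^+ 2 + w.1.1 ^+ 2 + w.2 ^+ 2).
have mK : measurable_fun setT K by rewrite /K; measurability.
have K0 z : (0 <= K z)%E by exact: H0.
transitivity (\int[lebesgue_measure]_z \int[lebesgue_measure]_x \int[lebesgue_measure]_y K (y, x, z))%E.
  apply: eq_integral => z _.
  pose G (w : R * R) := H (w.1 + t * z, w.2 + z ^+ 2).
  have mG : measurable_fun setT G by rewrite /G; measurability.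
  rewrite -[RHS](ge0_integral_rotation p q mG (fun w => H0 _)).
  apply: eq_integral => x _; apply: eq_integral => y _.
  by rewrite /G /dot3 /= !expr2 (mulrC x p) (mulrC y q) (mulrC z t).
transitivity (\int[lebesgue_measure]_z \int[lebesgue_measure]_y \int[lebesgue_measure]_x K (y, x, z))%E.
  apply: eq_integral => z _.
  have mG : measurable_fun setT (fun w => K (w.2, w.1, z)) by measurability.
  exact: (ge0_integral_swap mG (fun w => H0 _)).
(* Moving [y] outermost leaves [x] and [z] as the two inner variables, ready for the second
   rotation. *)
pose L (w : R * R) := (\int[lebesgue_measure]_x K (w.1, x, w.2))%E.
have mL : measurable_fun setT L.
  apply: (measurable_fun_fubini_tonelli_F (m2 := @lebesgue_measure R) (fun v => K (v.1.1, v.2, v.1.2))) => //.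
  by measurability.
have L0 z : (0 <= L z)%E by exact: integral_ge0.
rewrite -[LHS](ge0_integral_swap mL L0).
transitivity (\int[lebesgue_measure]_y \int[lebesgue_measure]_x \int[lebesgue_measure]_z
    H (norm3 (p, q, t) * x, x ^+ 2 + (y ^+ 2 + z ^+ 2))%R)%E.
  apply: eq_integral => y _; rewrite /L /=.
  have mG : measurable_fun setT (fun w => K (y, w.1, w.2)) by measurability.
  rewrite -[LHS](ge0_integral_swap mG (fun w => H0 _)).
  have -> : norm3 (p, q, t) = Num.sqrt (rho ^+ 2 + t ^+ 2).
    by rewrite sqr_sqrtr ?addr_ge0 ?sqr_ge0// /norm3 /dot3 /= !expr2.
  transitivity (\int[lebesgue_measure]_x \int[lebesgue_measure]_z
    H (Num.sqrt (rho ^+ 2 + t ^+ 2) * x, x ^+ 2 + z ^+ 2 + y ^+ 2)%R)%E.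
    pose L' (w : R * R) := H (w.1, w.2 + y ^+ 2).
    have mL' : measurable_fun setT L' by rewrite /L'; measurability.
    rewrite -[RHS](ge0_integral_rotation rho t mL' (fun w => H0 _)).
    by apply: eq_integral => x _; apply: eq_integral => z _; rewrite /L' /K /= addrAC.
  apply: eq_integral => x _; apply: eq_integral => z _; congr (H (_, _)); ring.
pose M (w : R * R) := (\int[lebesgue_measure]_z
  H (norm3 (p, q, t) * w.2, w.2 ^+ 2 + (w.1 ^+ 2 + z ^+ 2))%R)%E.
have mM : measurable_fun setT M.
  pose N (v : R * R * R) :=
    H (norm3 (p, q, t) * v.1.2, v.1.2 ^+ 2 + (v.1.1 ^+ 2 + v.2 ^+ 2)).
  have mN : measurable_fun setT N by rewrite /N; measurability.
  exact: (measurable_fun_fubini_tonelli_F (m2 := @lebesgue_measure R) N mN (fun v => H0 _)).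
have M0 z : (0 <= M z)%E by exact: integral_ge0.
exact: (ge0_integral_swap mM M0).
Qed.

(* Polar coordinates in the plane orthogonal to [r], then in the half-plane
   spanned by the axis and the radial direction: spherical coordinates with
   polar angle [atan s] and signed radius [w]. *)
Lemma ge0_integral_spherical (R : realType) (r : R * R * R) (H : R * R -> \bar R) :
  measurable_fun setT H -> (forall z, 0 <= H z)%E ->
  (\int[@lebesgue3 R]_k H (dot3 k r, dot3 k k) =
   pi%:E * \int[lebesgue_measure]_w \int[lebesgue_measure]_s
     ((w ^+ 2 * (`|s| * cosatan s ^+ 3))%:E *
      H (norm3 r * (w * cosatan s), w ^+ 2)%R))%E.
Proof.
move=> mH H0; rewrite ge0_integral_lebesgue3_axis//.
have cosatanD w s : (w * cosatan s) ^+ 2 + (w * cosatan s * s) ^+ 2 = w ^+ 2 :> R.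
  transitivity (w ^+ 2 * (cosatan s ^+ 2 * (1 + s ^+ 2))); first by ring.
  by rewrite cosatan_sqr mulVf ?mulr1// gt_eqF// ltr_pwDl// sqr_ge0.
pose K (z : R * R) := (`|z.2|%:E * H (norm3 r * z.1, z.1 ^+ 2 + z.2 ^+ 2)%R)%E.
have mK : measurable_fun setT K by rewrite /K; measurability.
have K0 z : (0 <= K z)%E by rewrite mule_ge0.
have mc2 : measurable_fun [set: R] (fun s : R => (cosatan s ^+ 2)%:E) by measurability.
(* In the plane orthogonal to the axis the integrand depends only on the squared radius, so the
   slope integrates out to [pi]; the Jacobian survives as the factor [|z.2|] of [K]. *)
transitivity (\int[lebesgue_measure]_x (pi%:E * \int[lebesgue_measure]_w K (x, w)))%E.
  apply: eq_integral => x _.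
  rewrite (@ge0_integral_polar _ (fun z => H (norm3 r * x, x ^+ 2 + (z.1 ^+ 2 + z.2 ^+ 2))%R))//=; last by measurability.
  transitivity (\int[lebesgue_measure]_s ((cosatan s ^+ 2)%:E *
      \int[lebesgue_measure]_w K (x, w)))%E.
    apply: eq_integral => s _; rewrite -ge0_integralZl//=; last 2 first.
    - by measurability.
    - by rewrite lee_fin sqr_ge0.
    apply: eq_integral => w _.
    by rewrite cosatanD /K /= muleA -EFinM mulrC.
  rewrite ge0_integralZr//=; first by rewrite integral_cosatan_sqr.
  - by move=> s _; rewrite lee_fin sqr_ge0.
  - exact: integral_ge0.
pose M (x : R) := (\int[lebesgue_measure]_w K (x, w))%E.
have mM : measurable_fun [set: R] M.
  exact: (measurable_fun_fubini_tonelli_F (m2 := @lebesgue_measure R) K mK K0).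
have M0 x : (0 <= M x)%E by exact: integral_ge0.
transitivity (pi%:E * \int[lebesgue_measure]_x M x)%E.
  have pi0 : (0 <= pi%:E :> \bar R)%E by rewrite lee_fin pi_ge0.
  by rewrite -ge0_integralZl.
(* The second passage to polar coordinates turns that factor into [|w * cosatan s * s|], whence the
   total weight [w ^+ 2 * (|s| * cosatan s ^+ 3)]. *)
apply: (congr1 (fun u => pi%:E * u)%E); rewrite [LHS](ge0_integral_polar mK K0).
pose N (z : R * R) := ((`|z.1| * cosatan z.2 ^+ 2)%:E *
   K (z.1 * cosatan z.2, z.1 * cosatan z.2 * z.2)%R)%E.
have mN : measurable_fun setT N by rewrite /N; measurability.
have N0 z : (0 <= N z)%E by rewrite mule_ge0// lee_fin mulr_ge0// sqr_ge0.
rewrite -[LHS](ge0_integral_swap mN N0).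
apply: eq_integral => w _; apply: eq_integral => s _.
rewrite /N /K /= cosatanD muleA -EFinM; congr (_%:E * _)%E.
rewrite !normrM (gtr0_norm (cosatan_gt0 s)) -(real_normK (num_real w)); ring.
Qed.

(** * Integrals over half-lines and dominated convergence *)

Lemma sin_atan (R : realType) (x : R) : sin (atan x) = x * cosatan x.
Proof. by rewrite -{2}(atanK x) /tan /cosatan mulfVK// gt_eqF//; exact: cosatan_gt0. Qed.

Section improper_integral.
Context {R : realType}.
Implicit Types (f g : R -> R) (x : R).

Lemma is_derive_continuous f (F : R -> R) : (forall x, is_derive x 1 F (f x)) -> continuous F.
Proof.
move=> dF x; apply: differentiable_continuous; apply/derivable1_diffP.
by have [] := dF x.
Qed.

Lemma ge0_integral0y_FTC (f F : R -> R) (l : R) : (forall x, 0 <= x -> 0 <= f x) ->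
  continuous f -> (forall x, is_derive x 1 F (f x)) -> F x @[x --> +oo] --> l ->
  (\int[lebesgue_measure]_(x in `[0%R, +oo[) (f x)%:E = (l - F 0)%:E)%E.
Proof.
move=> f0 cf dF Fl; rewrite EFinB; apply: ge0_continuous_FTC2y => //.
- exact: continuous_subspaceT.
- by apply: cvg_at_right_filter; exact: (is_derive_continuous dF).
- by move=> x _; rewrite derive1E; have [] := dF x.
Qed.

(* The sign-changing [f] is handled through the nonnegative [f + g] and [g]. *)
Lemma integral0y_dominated (f g F G : R -> R) (l m : R) :
  continuous f -> continuous g -> (forall x, 0 <= x -> `|f x| <= g x) ->
  (forall x, is_derive x 1 F (f x)) -> (forall x, is_derive x 1 G (g x)) ->
  F x @[x --> +oo] --> l -> G x @[x --> +oo] --> m ->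
  lebesgue_measure.-integrable `[0, +oo[ (EFin \o f) /\
  \int[lebesgue_measure]_(x in `[0, +oo[) f x = l - F 0.
Proof.
move=> cf cg fg dF dG Fl Gm.
have intg (u : R -> R) n : (forall x, 0 <= x -> 0 <= u x) -> continuous u ->
    (\int[lebesgue_measure]_(x in `[0%R, +oo[) (u x)%:E = n%:E)%E ->
    lebesgue_measure.-integrable `[0, +oo[ (EFin \o u).
  move=> u0 cu un; apply/integrableP; split.
    by apply/measurable_EFinP/measurable_funTS; exact: continuous_measurable_fun.
  under eq_integral => x.
    rewrite inE/= in_itv/= andbT => x0; rewrite ger0_norm ?u0//.
    over.
  by rewrite un ltry.
have g0 x : 0 <= x -> 0 <= g x by move=> x0; exact: le_trans (fg _ x0).
have fg0 x : 0 <= x -> 0 <= f x + g x.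
  by move=> x0; have := fg x x0; rewrite ler_norml => /andP[+ _]; rewrite -subr_ge0 opprK.
have cfg : continuous (fun x => f x + g x) by move=> x; apply: cvgD; [exact: cf|exact: cg].
have Ig := ge0_integral0y_FTC g0 cg dG Gm.
have FGlm : (F x + G x) @[x --> +oo] --> l + m by exact: cvgD.
have dFG x : is_derive x 1 (fun x => F x + G x) (f x + g x) by exact: is_deriveD.
have Ifg := ge0_integral0y_FTC fg0 cfg dFG FGlm.
have ig := intg _ _ g0 cg Ig.
have ifg := intg _ _ fg0 cfg Ifg.
have if_ : lebesgue_measure.-integrable `[0, +oo[ (EFin \o f).
  apply: le_integrable ig => //.
    by apply/measurable_EFinP/measurable_funTS; exact: continuous_measurable_fun.
  move=> x /=; rewrite in_itv/= andbT => x0; rewrite lee_fin (le_trans (fg x x0))//.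
  exact: ler_norm.
split=> //.
have := RintegralD _ if_ ig; rewrite {1 3}/Rintegral Ifg Ig /= => /(_ ltac:(by [])) E.
by apply/eqP; rewrite -(inj_eq (addIr (m - G 0))) -E; apply/eqP; ring.
Qed.

End improper_integral.

(** * Integration over the polar angle *)

Lemma cvgy_cosatan (R : realType) : @cosatan R x @[x --> +oo] --> (0 : R).
Proof.
rewrite -(@cos_pihalf R); apply: continuous_cvg; first exact: continuous_cos.
exact: cvgy_atan.
Qed.

(** With [t = cosatan s] one has $dt=-s\,(1+s^2)^{-3/2}ds$, so the weight is that of $2\int_0^1
    c(wt)\,dt$, the integral over the cosine of the polar angle. *)
Lemma integral_cosatan3 (R : realType) (c S : R -> R) (w : R) : w != 0 ->
  (forall x, 0 <= c x) -> continuous c -> (forall x : R, is_derive x 1 S (c x)) ->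
  (\int[lebesgue_measure]_s (`|s| * cosatan s ^+ 3 * c (w * cosatan s))%:E =
   (2 * ((S w - S 0) / w))%:E)%E.
Proof.
move=> w0 c0 cc dS.
have ca3 (s : R) : 0 <= cosatan s ^+ 3 by rewrite exprn_ge0// ltW// cosatan_gt0.
have cca : continuous (@cosatan R) by exact: continuous_cosatan.
have cca3 : continuous (fun s : R => cosatan s ^+ 3).
  by move=> s; apply: (@continuous_comp _ _ _ (@cosatan R) (fun x => x ^+ 3)); [exact: cca|exact: exprn_continuous].
have ccw : continuous (fun s : R => c (w * cosatan s)).
  move=> s; apply: (@continuous_comp _ _ _ (fun s => w * cosatan s) c); last exact: cc.
  by apply: cvgM; [exact: cvg_cst|exact: cca].
rewrite ge0_symfun_integralT; last 3 first.
- by move=> s; rewrite mulr_ge0// mulr_ge0.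
- move=> s; apply: cvgM; last exact: ccw.
  by apply: cvgM; [exact: norm_continuous|exact: cca3].
- by move=> s /=; rewrite normrN /cosatan atanN cosN.
rewrite -set_itvcy.
transitivity (2%:E * \int[lebesgue_measure]_(s in `[0%R, +oo[)
    (s * cosatan s ^+ 3 * c (w * cosatan s))%:E)%E.
  congr (_ * _)%E; apply: eq_integral => s; rewrite inE/= in_itv/= andbT => s0.
  by rewrite ger0_norm.
(* As [s] runs from 0 to infinity, [cosatan s] decreases from 1 to 0, hence the minus sign in the
   primitive. *)
have dF (s : R) : is_derive s 1 (fun s => - (w^-1 * S (w * cosatan s)))
    (s * cosatan s ^+ 3 * c (w * cosatan s)).
  apply: is_derive_eq; rewrite /GRing.scale /= sin_atan -cosatan_sqr.
  by field.
rewrite (@ge0_integral0y_FTC R _ _ (- (w^-1 * S 0)) _ _ dF).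
- rewrite -EFinM; congr (_%:E).
  have -> : cosatan (0 : R) = 1 by rewrite /cosatan atan0 cos0.
  by rewrite mulr1; field.
- by move=> s s0; rewrite mulr_ge0// mulr_ge0.
- move=> s; apply: cvgM; last exact: ccw.
  by apply: cvgM; [exact: cvg_id|exact: cca3].
- apply: cvgN; apply: cvgM; first exact: cvg_cst.
  rewrite -[X in S X](mulr0 w); apply: continuous_cvg.
    exact: (is_derive_continuous dS).
  by apply: cvgM; [exact: cvg_cst|exact: cvgy_cosatan].
Qed.

(** The angular integral brings the denominator [norm3 r * w], which cancels one factor of the
    volume element [w ^+ 2]. Here [S] increases, so [w * (S (norm3 r * w) - S 0)] is nonnegative for
    both signs of [w]. *)
Lemma ge0_integral_radial3 (R : realType) (r : R * R * R) (c S f : R -> R) :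
  0 < norm3 r -> (forall x, 0 <= c x) -> continuous c ->
  (forall x : R, is_derive x 1 S (c x)) ->
  measurable_fun [set: R] f -> (forall x, 0 <= f x) ->
  (\int[@lebesgue3 R]_k (c (dot3 k r) * f (dot3 k k))%:E =
   \int[lebesgue_measure]_w (2 * pi / norm3 r *
     (w * f (w ^+ 2) * (S (norm3 r * w) - S 0)))%:E)%E.
Proof.
move=> r0 c0 cc dS mf f0.
have mc : measurable_fun [set: R] c by exact: continuous_measurable_fun.
pose H (z : R * R) := (c z.1 * f z.2)%:E.
have mH : measurable_fun setT H by rewrite /H; measurability.
have H0 z : (0 <= H z)%E by rewrite lee_fin mulr_ge0.
rewrite [LHS](ge0_integral_spherical r mH H0).
have ca3 (s : R) : 0 <= cosatan s ^+ 3 by rewrite exprn_ge0// ltW// cosatan_gt0.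
pose N (z : R * R) := ((z.1 ^+ 2 * (`|z.2| * cosatan z.2 ^+ 3))%:E *
      H (norm3 r * (z.1 * cosatan z.2), z.1 ^+ 2)%R)%E.
have mN : measurable_fun setT N by rewrite /N; measurability.
have N0 z : (0 <= N z)%E.
  by rewrite mule_ge0// lee_fin mulr_ge0 ?sqr_ge0// mulr_ge0.
pose M (x : R) := (\int[lebesgue_measure]_s N (x, s))%E.
have mM : measurable_fun [set: R] M.
  exact: (measurable_fun_fubini_tonelli_F (m2 := @lebesgue_measure R) N mN N0).
have M0 x : (0 <= M x)%E by exact: integral_ge0.
have pi0 : (0 <= pi%:E :> \bar R)%E by rewrite lee_fin pi_ge0.
transitivity (\int[lebesgue_measure]_w (pi%:E * M w))%E.
  by rewrite [RHS]ge0_integralZl.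
apply: eq_integral => w _; rewrite /M /N /=.
(* At [w = 0] the quotient by [w] is meaningless, but both integrands vanish. *)
have [->|w0] := eqVneq w 0.
  rewrite expr0n/= !mul0r mulr0 integral0_eq ?mule0// => s _.
  by rewrite mul0r mul0e.
have rw0 : norm3 r * w != 0 by rewrite mulf_neq0// gt_eqF.
transitivity (pi%:E * ((w ^+ 2 * f (w ^+ 2))%:E * \int[lebesgue_measure]_s
    (`|s| * cosatan s ^+ 3 * c (norm3 r * w * cosatan s))%:E))%E.
  congr (_ * _)%E; rewrite -ge0_integralZl_EFin//=.
  - apply: eq_integral => s _; rewrite /H -!EFinM; congr (_%:E).
    by rewrite /= mulrA; ring.
  - by move=> s _; rewrite lee_fin mulr_ge0// mulr_ge0.
  - by measurability.
  - by rewrite mulr_ge0// sqr_ge0.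
have r0' : norm3 r != 0 by rewrite gt_eqF.
by rewrite (integral_cosatan3 rw0 c0 cc dS) -!EFinM; congr (_%:E); field; rewrite r0'.
Qed.

(** * Signed integrals: substitution, dominated convergence, folding of the line *)

Lemma Rintegral_affine (R : realType) (a b : R) (f : R -> R) : a != 0 ->
  lebesgue_measure.-integrable [set: R] (EFin \o f) ->
  \int[lebesgue_measure]_x f x = `|a| * \int[lebesgue_measure]_x f (a * x + b).
Proof.
move=> a0 intf.
have mf : measurable_fun [set: R] (EFin \o f) := measurable_int _ intf.
have a0' : 0 < `|a| by rewrite normr_gt0.
(* The formula for nonnegative functions is applied to the positive and negative parts, both of
   finite integral. *)
have Ep := ge0_integral_affine b a0 (measurable_funepos mf) (fun x => funepos_ge0 _ x).
have En := ge0_integral_affine b a0 (measurable_funeneg mf) (fun x => funeneg_ge0 _ x).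
have fp := integrable_pos_fin_num measurableT intf.
have fn := integrable_neg_fin_num measurableT intf.
rewrite /Rintegral integralE [in RHS]integralE.
have divE (x y : \bar R) : x \is a fin_num -> (x = `|a|%:E * y)%E -> y = ((`|a|^-1)%:E * x)%E.
  by move=> xf ->; rewrite muleA -EFinM mulVf ?mul1e// gt_eqF.
have Ep' := divE _ _ fp Ep.
have En' := divE _ _ fn En.
transitivity (`|a| * fine (\int[lebesgue_measure]_x ((EFin \o f)^\+)%E (a * x + b)%R -
    \int[lebesgue_measure]_x ((EFin \o f)^\-)%E (a * x + b)%R)%E); last first.
  by congr (_ * fine (_ - _)%E); apply: eq_integral => x _; rewrite ?funeposE ?funenegE.
rewrite Ep' En'.
rewrite -(fineK fp) -(fineK fn) -!EFinM -!EFinB /=.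
by field; rewrite gt_eqF.
Qed.

Lemma Rintegral_dominated_cvg d (T : measurableType d) (R : realType)
    (mu : {measure set T -> \bar R}) (f_ : nat -> T -> R) (f g : T -> R) :
  (forall n, measurable_fun setT (f_ n)) ->
  (forall x, f_ n x @[n --> \oo] --> f x) ->
  mu.-integrable setT (EFin \o g) -> (forall n x, `|f_ n x| <= g x) ->
  \int[mu]_x f_ n x @[n --> \oo] --> \int[mu]_x f x.
Proof.
move=> mf_ f_f ig fg.
have g0 x : 0 <= g x by exact: le_trans (fg 0%N x).
have mfE n : measurable_fun setT (EFin \o f_ n) by exact/measurable_EFinP.
have f_fE x : [set: T] x -> (f_ n x)%:E @[n --> \oo] --> (f x)%:E.
  by move=> _; apply: cvg_EFin; [exact: nearW|exact: f_f].
have fgE n x : [set: T] x -> (`|(f_ n x)%:E| <= (g x)%:E)%E by rewrite lee_fin.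
have mf : measurable_fun setT (EFin \o f) := emeasurable_fun_cvg _ _ mfE f_fE.
have [if_ _ cvf] := dominated_convergence measurableT mfE mf (aeW mu f_fE) ig
  (aeW mu (fun x n => fgE n x)).
by apply: fine_cvg; rewrite fineK; [exact: cvf|exact: integrable_fin_num].
Qed.

(** Integrability passes from the substituted function back to [f]. Applied to a substituted
    function and the inverse substitution, it yields the opposite direction as well. *)
Lemma integrable_affine (R : realType) (a b : R) (f : R -> R) : a != 0 ->
  measurable_fun [set: R] f ->
  lebesgue_measure.-integrable [set: R] (fun x => (f (a * x + b))%:E) ->
  lebesgue_measure.-integrable [set: R] (EFin \o f).
Proof.
move=> a0 mf /integrableP[_ foo]; apply/integrableP; split; first exact/measurable_EFinP.
have mnf : measurable_fun [set: R] (fun x => `|(f x)%:E|%E).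
  by apply/measurable_EFinP; measurability.
rewrite (ge0_integral_affine b a0 mnf (fun x => abse_ge0 _)).
by rewrite lte_mul_pinfty// lee_fin.
Qed.

Lemma integral_fold (R : realType) (f : R -> R) : measurable_fun [set: R] f ->
  lebesgue_measure.-integrable `[0, +oo[ (EFin \o f) ->
  lebesgue_measure.-integrable `[0, +oo[ (fun x => (f (- x))%:E) ->
  lebesgue_measure.-integrable [set: R] (EFin \o f) /\
  \int[lebesgue_measure]_x f x =
  \int[lebesgue_measure]_(x in `[0, +oo[) (f x + f (- x)).
Proof.
move=> mf ip iN.
have mN : measurable_fun [set: R] (fun x => f (- x)).
  by apply: (measurableT_comp mf); exact: oppr_measurable.
pose P := f \_ `[0, +oo[; pose N := f \_ `]-oo, 0[.
have fPN x : f x = P x + N x.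
  rewrite /P /N !patchE !mem_setE !in_itv /= andbT.
  by case: leP; rewrite ?addr0 ?add0r.
have NE x : N (-1 * x + 0) = ((fun x => f (- x)) \_ `]0, +oo[) x.
  by rewrite /N !patchE !mem_setE !in_itv /= andbT mulN1r addr0 oppr_lt0.
have iP : lebesgue_measure.-integrable [set: R] (EFin \o P).
  by have := (integrable_mkcond (mu := @lebesgue_measure R) _ (measurable_itv _)).1 ip; rewrite restrict_EFin.
have iNo : lebesgue_measure.-integrable `]0, +oo[ (fun x => (f (- x))%:E).
  by apply: integrableS iN => //; apply: subset_itvr; rewrite bnd_simp.
have n10 : -1 != 0 :> R by rewrite oppr_eq0 oner_eq0.
have iNN : lebesgue_measure.-integrable [set: R] (EFin \o N).
  apply: (@integrable_affine _ (-1) 0) => //.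
    by apply/(measurable_restrictT _ _).1 => //; exact: measurable_funTS.
  under eq_fun do rewrite NE.
  by have := (integrable_mkcond (mu := @lebesgue_measure R) _ (measurable_itv _)).1 iNo; rewrite restrict_EFin.
have eP : \int[lebesgue_measure]_x P x = \int[lebesgue_measure]_(x in `[0, +oo[) f x.
  by rewrite [RHS]Rintegral_mkcond.
have eN : \int[lebesgue_measure]_x N x = \int[lebesgue_measure]_(x in `[0, +oo[) f (- x).
  (* The reflection of [N] lives on the open half-line; the endpoint 0 is added back as a null
     set. *)
  rewrite (Rintegral_affine 0 n10 iNN) normrN normr1 mul1r -Rintegral_itv_obnd_cbnd//.
  by rewrite [RHS]Rintegral_mkcond; apply: eq_Rintegral => x _; rewrite NE.
split.
  have := integrableD measurableT iP iNN; apply: eq_integrable => // x _.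
  by rewrite /= -EFinD -fPN.
rewrite RintegralD// -eP -eN -RintegralD//.
by apply: eq_Rintegral => x _; exact: fPN.
Qed.

Lemma cvgr0_le_norm (R : realType) (f g : R -> R) : (forall x, 0 <= x -> `|f x| <= g x) ->
  g x @[x --> +oo] --> 0 -> f x @[x --> +oo] --> 0.
Proof.
move=> fg g0; apply/norm_cvg0P.
apply: (@squeeze_cvgr _ _ _ _ (fun=> 0) g) => //; last exact: cvg_cst.
by near=> x; rewrite normr_ge0/= fg//; near: x; exact: nbhs_pinfty_ge.
Unshelve. all: end_near. Qed.

Lemma cvgr_expRM (R : realType) (a : R) : 0 < a -> expR (- (a * x)) @[x --> +oo] --> 0.
Proof.
move=> a0; apply: (cvg_comp (fun x => a * x) (fun x => expR (- x))); last exact: cvgr_expR.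
by apply: gt0_cvgMry => //; exact: cvg_id.
Qed.

Lemma integral0y_expRM (R : realType) (a : R) : 0 < a ->
  lebesgue_measure.-integrable `[0, +oo[ (fun x => (expR (- (a * x)))%:E).
Proof.
move=> a0; pose f (x : R) := expR (- (a * x)).
have cf : continuous f.
  move=> x; apply: continuous_comp; last exact: continuous_expR.
  by apply: cvgN; apply: cvgM; [exact: cvg_cst|exact: cvg_id].
have dF (x : R) : is_derive x 1 (fun x => - (a^-1 * f x)) (f x).
  by apply: is_derive_eq; rewrite /GRing.scale /= /f; field; rewrite gt_eqF.
apply: (proj1 (integral0y_dominated cf cf _ dF dF _ _)).
- by move=> x _; rewrite ger0_norm// expR_ge0.
- by apply: cvgN; apply: cvgM; [exact: cvg_cst|exact: cvgr_expRM].
- by apply: cvgN; apply: cvgM; [exact: cvg_cst|exact: cvgr_expRM].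
Qed.

(** * Fourier inversion by Abel summation *)

Ltac derivable_continuous :=
  move=> ?; apply: differentiable_continuous; apply/derivable1_diffP; exact: ex_derive.

(** Tonelli's theorem bounds the double integral of [|f|] by the product of the integrals of [|p|]
    and [|q|], so Fubini's theorem applies. *)
Lemma Rintegral_swap (R : realType) (f : R * R -> R) (p q : R -> R) :
  measurable_fun setT f ->
  lebesgue_measure.-integrable [set: R] (EFin \o p) ->
  lebesgue_measure.-integrable [set: R] (EFin \o q) ->
  (forall x y, `|f (x, y)| <= p x * q y) ->
  \int[lebesgue_measure]_x \int[lebesgue_measure]_y f (x, y) =
  \int[lebesgue_measure]_y \int[lebesgue_measure]_x f (x, y).
Proof.
move=> mf ip iq fpq.
have mfE : measurable_fun setT (EFin \o f) by exact/measurable_EFinP.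
have mp : measurable_fun [set: R] p by apply/measurable_EFinP; exact: measurable_int ip.
have mq : measurable_fun [set: R] q by apply/measurable_EFinP; exact: measurable_int iq.
have iy x : lebesgue_measure.-integrable [set: R] (fun y => (f (x, y))%:E).
  have := integrableZl measurableT (p x) iq; apply: le_integrable => //.
    by apply: (measurableT_comp mfE); exact: measurable_fun_pair.
  by move=> y _; rewrite lee_fin (le_trans (fpq x y))// ler_norm.
have ix y : lebesgue_measure.-integrable [set: R] (fun x => (f (x, y))%:E).
  have := integrableZl measurableT (q y) ip; apply: le_integrable => //.
    by apply: (measurableT_comp mfE); exact: measurable_fun_pair.
  by move=> x _; rewrite lee_fin (le_trans (fpq x y))// mulrC ler_norm.
have ixy : (lebesgue_measure \x lebesgue_measure)%E.-integrable setT (EFin \o f).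
  apply/integrable12ltyP => //.
  pose g (z : R * R) := (`|p z.1| * `|q z.2|)%:E.
  have mg : measurable_fun setT g by rewrite /g; measurability.
  have g0 z : (0 <= g z)%E by rewrite lee_fin mulr_ge0.
  pose k (z : R * R) := (`|f z|)%:E.
  have mk : measurable_fun setT k by rewrite /k; measurability.
  have k0 z : (0 <= k z)%E by rewrite lee_fin.
  change (\int[lebesgue_measure]_x \int[lebesgue_measure]_y k (x, y) < +oo)%E.
  apply: (@le_lt_trans _ _ (\int[lebesgue_measure]_x \int[lebesgue_measure]_y g (x, y))%E).
    apply: ge0_le_integral => //=.
    - by move=> ? _; exact: integral_ge0.
    - exact: (measurable_fun_fubini_tonelli_F (m2 := @lebesgue_measure R) k mk k0).
    - exact: (measurable_fun_fubini_tonelli_F (m2 := @lebesgue_measure R) g mg g0).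
    - move=> x _; apply: ge0_le_integral => //=.
      + by apply: (measurableT_comp mk); exact: measurable_fun_pair.
      + by apply: (measurableT_comp mg); exact: measurable_fun_pair.
      + by move=> y _; rewrite lee_fin -normrM (le_trans (fpq x y))// ler_norm.
  have -> : (\int[lebesgue_measure]_x \int[lebesgue_measure]_y g (x, y) =
      \int[lebesgue_measure]_x ((`|p x|)%:E * \int[lebesgue_measure]_y (`|q y|)%:E))%E.
    by apply: eq_integral => x _; rewrite -ge0_integralZl//=; measurability.
  move/integrableP : ip => [_ ip]; move/integrableP : iq => [_ iq].
  rewrite ge0_integralZr//=; first last.
  - exact: integral_ge0.
  - by measurability.
  by apply: lte_mul_pinfty => //; [exact: integral_ge0|rewrite ge0_fin_numE//; exact: integral_ge0].
rewrite /Rintegral; congr fine.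
transitivity (\int[lebesgue_measure]_x \int[lebesgue_measure]_y (EFin \o f) (x, y))%E.
  by apply: eq_integral => x _; rewrite fineK// integrable_fin_num.
rewrite (Fubini ixy).
by apply: eq_integral => x _; rewrite fineK// integrable_fin_num.
Qed.

Lemma integral0y_expR_cos_sin (R : realType) (a b p q : R) : 0 < a ->
  lebesgue_measure.-integrable `[0, +oo[
    (fun x => (expR (- (a * x)) * (p * cos (b * x) + q * sin (b * x)))%:E) /\
  \int[lebesgue_measure]_(x in `[0, +oo[)
    (expR (- (a * x)) * (p * cos (b * x) + q * sin (b * x))) =
    (a * p + b * q) / (a ^+ 2 + b ^+ 2).
Proof.
move=> a0; have ab0 : a ^+ 2 + b ^+ 2 != 0 by rewrite gt_eqF// ltr_wpDr ?sqr_ge0// exprn_gt0.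
have an0 : a != 0 by rewrite gt_eqF.
have trig_le (c d x : R) : `|c * cos x + d * sin x| <= `|c| + `|d|.
  rewrite (le_trans (ler_normD _ _))// lerD// normrM ler_piMr//.
    by rewrite ler_norml cos_geN1 cos_le1.
  by rewrite ler_norml sin_geN1 sin_le1.
(* These coefficients solve $bd-ac=(a^2+b^2)p$ and $-ad-bc=(a^2+b^2)q$, which is what
   differentiating [F] requires. *)
pose c := - (a * p + b * q); pose d := b * p - a * q.
pose F (x : R) := expR (- (a * x)) * (c * cos (b * x) + d * sin (b * x)) / (a ^+ 2 + b ^+ 2).
pose f (x : R) := expR (- (a * x)) * (p * cos (b * x) + q * sin (b * x)).
pose G (x : R) := - (a^-1 * (expR (- (a * x)) * (`|p| + `|q|))).
pose g (x : R) := expR (- (a * x)) * (`|p| + `|q|).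
have cf : continuous f by derivable_continuous.
have cg : continuous g by derivable_continuous.
have dF (x : R) : is_derive x 1 F (f x).
  by rewrite /F; apply: is_derive_eq; rewrite /GRing.scale /= /f /c /d; field.
have dG (x : R) : is_derive x 1 G (g x).
  by rewrite /G; apply: is_derive_eq; rewrite /GRing.scale /= /g; field.
have fg x : 0 <= x -> `|f x| <= g x.
  by move=> _; rewrite normrM ger0_norm ?expR_ge0// ler_wpM2l ?expR_ge0.
have G0 : G x @[x --> +oo] --> - (a^-1 * (0 * (`|p| + `|q|))).
  apply: cvgN; apply: cvgM; first exact: cvg_cst.
  by apply: cvgM; [exact: cvgr_expRM|exact: cvg_cst].
have F0 : F x @[x --> +oo] --> 0.
  rewrite -[X in _ --> X](mul0r (a ^+ 2 + b ^+ 2)^-1); apply: cvgM; last exact: cvg_cst.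
  apply: (@cvgr0_le_norm _ _ (fun x => expR (- (a * x)) * (`|c| + `|d|))).
    by move=> x _; rewrite normrM ger0_norm ?expR_ge0// ler_wpM2l ?expR_ge0.
  rewrite -[X in _ --> X](mul0r (`|c| + `|d|)).
  by apply: cvgM; [exact: cvgr_expRM|exact: cvg_cst].
have [intf If] := integral0y_dominated cf cg fg dF dG F0 G0.
split; first exact: intf.
by rewrite [LHS]If /F /c !mulr0 oppr0 expR0 sin0 cos0; field.
Qed.

(** The Fourier transform of the two-sided exponential is, up to normalisation, the Poisson kernel;
    this is what makes the exponential a convenient Abel factor. *)
Lemma integral_expR_norm_cos (R : realType) (a b : R) : 0 < a ->
  lebesgue_measure.-integrable [set: R] (fun x => (expR (- (a * `|x|)) * cos (b * x))%:E) /\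
  \int[lebesgue_measure]_x (expR (- (a * `|x|)) * cos (b * x)) =
    2 * a / (a ^+ 2 + b ^+ 2).
Proof.
move=> a0; have [i0 I0] : lebesgue_measure.-integrable `[0, +oo[ (fun x => (expR (- (a * x)) * cos (b * x))%:E) /\
    \int[lebesgue_measure]_(x in `[0, +oo[) (expR (- (a * x)) * cos (b * x)) = a / (a ^+ 2 + b ^+ 2).
  have [i1 I1] := integral0y_expR_cos_sin b 1 0 a0; split.
    by have := i1; apply: eq_integrable => // x _; rewrite mul1r mul0r addr0.
  move: I1; rewrite mulr1 mulr0 addr0 => <-.
  by apply: eq_Rintegral => x _; rewrite mul1r mul0r addr0.
have mf : measurable_fun [set: R] (fun x : R => expR (- (a * `|x|)) * cos (b * x)) by measurability.
have [||intf ->] := integral_fold mf.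
- apply: eq_integrable i0 => // x; rewrite inE/= in_itv/= andbT => x0.
  by rewrite ger0_norm.
- apply: eq_integrable i0 => // x; rewrite inE/= in_itv/= andbT => x0.
  by rewrite normrN ger0_norm// mulrN cosN.
split=> //.
transitivity (\int[lebesgue_measure]_(x in `[0, +oo[) (2 * (expR (- (a * x)) * cos (b * x)))).
  apply: eq_Rintegral => x; rewrite inE/= in_itv/= andbT => x0.
  by rewrite normrN ger0_norm// mulrN cosN; ring.
by rewrite RintegralZl// I0 mulrA.
Qed.

Lemma integrable_cosatan_sqr (R : realType) :
  lebesgue_measure.-integrable [set: R] (fun t => (cosatan t ^+ 2)%:E).
Proof.
apply/integrableP; split; first by measurability.
under eq_integral => t _ do rewrite gee0_abs ?lee_fin ?sqr_ge0//.
by rewrite integral_cosatan_sqr ltry.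
Qed.

(* Abel summation: against the kernel [expR (- e * `|u|)] the double integral
   becomes a Poisson integral of [phi], which tends to [2 * pi * phi h]. *)
Lemma Rintegral_cosine_inversion (R : realType) (phi : R -> R) (h M : R) :
  measurable_fun [set: R] phi -> (forall y, `|phi y| <= M) ->
  lebesgue_measure.-integrable [set: R] (EFin \o phi) ->
  {for h, continuous phi} ->
  let Phi u := \int[lebesgue_measure]_y (phi y * cos ((y - h) * u)) in
  lebesgue_measure.-integrable [set: R] (EFin \o Phi) ->
  \int[lebesgue_measure]_u Phi u = 2 * pi * phi h.
Proof.
move=> mphi bphi iphi cphi Phi iPhi.
pose e (n : nat) : R := n.+1%:R^-1.
have e0 n : 0 < e n by rewrite invr_gt0.
have en0 n : e n != 0 by rewrite gt_eqF.
have e_cvg (c : R) : e n * c @[n --> \oo] --> 0.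
  by rewrite -(mul0r c); apply: cvgM; [exact: cvg_harmonic|exact: cvg_cst].
pose K n (u : R) := expR (- (e n * `|u|)).
have K0 n u : 0 <= K n u by exact: expR_ge0.
have K1 n u : K n u <= 1.
  by rewrite /K -[leRHS]expR0 ler_expR oppr_le0 mulr_ge0// ltW.
have mPhi : measurable_fun [set: R] Phi.
  by apply/measurable_EFinP; exact: measurable_int iPhi.
have mK n : measurable_fun [set: R] (K n) by rewrite /K; measurability.
have lim1 : \int[lebesgue_measure]_u (K n u * Phi u) @[n --> \oo] -->
    \int[lebesgue_measure]_u Phi u.
  apply: (@Rintegral_dominated_cvg _ (measurableTypeR R) R lebesgue_measure
    (fun n u => K n u * Phi u) Phi (fun u => `|Phi u|)).
  - by move=> n; exact: (measurable_funM (mK n) mPhi).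
  - move=> u; rewrite -[X in _ --> X]mul1r; apply: cvgM; last exact: cvg_cst.
    rewrite /K -expR0 -oppr0; apply: continuous_cvg; first exact: continuous_expR.
    by apply: cvgN; exact: e_cvg.
  - exact: integrable_norm iPhi.
  - by move=> n u; rewrite normrM ger0_norm// ler_piMl.
have iK n : lebesgue_measure.-integrable [set: R] (EFin \o K n).
  have := (integral_expR_norm_cos 0 (e0 n)).1; apply: eq_integrable => // u _.
  by rewrite mul0r cos0 mulr1.
have iphicos u : lebesgue_measure.-integrable [set: R] (fun y => (phi y * cos ((y - h) * u))%:E).
  apply: le_integrable iphi => //; first by measurability.
  move=> y _; rewrite lee_fin normrM ler_piMr// ler_norml cos_geN1 cos_le1//.
have E1 n : \int[lebesgue_measure]_u (K n u * Phi u) =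
    \int[lebesgue_measure]_t (phi (e n * t + h) * (2 * cosatan t ^+ 2)).
  pose f (z : R * R) := K n z.1 * (phi z.2 * cos ((z.2 - h) * z.1)).
  have mKn := mK n.
  have mf : measurable_fun setT f by rewrite /f; measurability.
  transitivity (\int[lebesgue_measure]_u \int[lebesgue_measure]_y f (u, y)).
    by apply: eq_Rintegral => u _; rewrite /f /= RintegralZl//; exact: iphicos.
  rewrite (@Rintegral_swap _ f (K n) (fun y => `|phi y|)) //; last 2 first.
  - exact: integrable_norm iphi.
  - move=> u y; rewrite /f /= !normrM ger0_norm// ler_wpM2l// ler_piMr//.
    by rewrite ler_norml cos_geN1 cos_le1.
  (* After the exchange the inner integral over [u] is the Poisson kernel of width [e n] centred at
     [h]. *)
  transitivity (\int[lebesgue_measure]_y (phi y * (2 * e n / (e n ^+ 2 + (y - h) ^+ 2)))).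
    apply: eq_Rintegral => y _; have [iy Iy] := integral_expR_norm_cos (y - h) (e0 n).
    rewrite -Iy -RintegralZl//.
    by apply: eq_Rintegral => u _; rewrite /f /= /K; ring.
  have eD (x : R) : 0 < e n ^+ 2 + x ^+ 2 by rewrite ltr_pwDl ?sqr_ge0// exprn_gt0.
  pose P (y : R) := phi y * (2 * e n / (e n ^+ 2 + (y - h) ^+ 2)).
  have iP : lebesgue_measure.-integrable [set: R] (EFin \o P).
    (* For fixed [n] the kernel is at most [2 / e n], its value at the centre. *)
    apply: (le_integrable _ _ _ (integrableZl _ (2 / e n) iphi)) => //=.
    - apply/measurable_EFinP; apply: measurable_funM => //.
      apply: continuous_measurable_fun => y; apply: cvgM; first exact: cvg_cst.
      apply: cvgV; first by rewrite gt_eqF.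
      apply: cvgD; first exact: cvg_cst.
      apply: (@continuous_comp _ _ _ (fun y => y - h) (fun x => x ^+ 2)); last exact: exprn_continuous.
      by apply: cvgB; [exact: cvg_id|exact: cvg_cst].
    - move=> y _; rewrite lee_fin normrM [leRHS]normrM mulrC ler_wpM2r//.
      have q0 : 0 <= 2 * e n / (e n ^+ 2 + (y - h) ^+ 2).
        by rewrite divr_ge0// ?mulr_ge0// ltW.
      have q1 : 0 <= 2 / e n by rewrite divr_ge0// ltW.
      rewrite (ger0_norm q0) (ger0_norm q1) ler_pdivrMr//.
      rewrite (_ : 2 * e n = 2 / e n * e n ^+ 2); last by field.
      by rewrite ler_pM2l ?divr_gt0// lerDl sqr_ge0.
  have iPa : lebesgue_measure.-integrable [set: R] (fun t => (P (e n * t + h))%:E).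
    apply: (@integrable_affine _ (e n)^-1 (- (h / e n)) (fun t => P (e n * t + h))).
    - by rewrite invr_eq0.
    - by apply: measurableT_comp; [apply/measurable_EFinP; exact: measurable_int iP|measurability].
    - have := iP; apply: eq_integrable => // y _ /=; congr (P _)%:E; by field.
  (* Rescaling by [y = e n * t + h] makes the kernel independent of [n] and leaves [n] only in the
     argument of [phi]. *)
  rewrite (Rintegral_affine h (en0 n) iP) gtr0_norm// -RintegralZl//.
  apply: eq_Rintegral => t _; rewrite /P addrK cosatan_sqr.
  have t1 : 1 + t ^+ 2 != 0 by rewrite gt_eqF// ltr_pwDl// sqr_ge0.
  by field; rewrite t1 gt_eqF.
have lim2 : \int[lebesgue_measure]_u (K n u * Phi u) @[n --> \oo] --> 2 * pi * phi h.
  under eq_cvg do rewrite E1.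
  have -> : 2 * pi * phi h = \int[lebesgue_measure]_t (phi h * (2 * cosatan t ^+ 2)).
    rewrite RintegralZl//; last first.
      exact: (integrableZl measurableT 2 (@integrable_cosatan_sqr R)).
    rewrite RintegralZl//; last exact: integrable_cosatan_sqr.
    by rewrite /Rintegral integral_cosatan_sqr/=; ring.
  have mt n : measurable_fun [set: R] (fun t => phi (e n * t + h) * (2 * cosatan t ^+ 2)) by measurability.
  (* Continuity of [phi] at [h] gives the pointwise limit, and the uniform bound [M] makes a
     multiple of the Cauchy density dominate. *)
  apply: (@Rintegral_dominated_cvg _ (measurableTypeR R) R lebesgue_measure
    (fun n t => phi (e n * t + h) * (2 * cosatan t ^+ 2))
    (fun t => phi h * (2 * cosatan t ^+ 2)) (fun t => M * 2 * cosatan t ^+ 2)).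
  - exact: mt.
  - move=> t; apply: cvgM; last exact: cvg_cst.
    apply: continuous_cvg; first exact: cphi.
    by rewrite -[X in _ --> X]add0r; apply: cvgD; [exact: e_cvg|exact: cvg_cst].
  - exact: (integrableZl measurableT (M * 2) (@integrable_cosatan_sqr R)).
  - move=> n t; rewrite normrM -mulrA ler_pM// ger0_norm//.
    by rewrite mulr_ge0// sqr_ge0.
exact: (cvg_unique (@norm_hausdorff _ _) lim1 lim2).
Qed.

(** Cosine inversion is applied to the odd extension [phi] of [psi]: by
    $\cos(\alpha-\beta)-\cos(\alpha+\beta)=2\sin\alpha\sin\beta$, its transform centred at [h] is
    [2 * (m u * sin (h * u))]. *)
Lemma Rintegral_sine_inversion (R : realType) (psi m : R -> R) (h M : R) : 0 < h ->
  continuous psi -> (forall y, 0 <= y -> `|psi y| <= M) ->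
  lebesgue_measure.-integrable `[0, +oo[ (EFin \o psi) ->
  (forall u, \int[lebesgue_measure]_(y in `[0, +oo[) (psi y * sin (y * u)) = m u) ->
  lebesgue_measure.-integrable [set: R] (EFin \o m) ->
  \int[lebesgue_measure]_u (m u * sin (h * u)) = pi * psi h.
Proof.
move=> h0 cpsi bpsi ipsi psim im.
pose P := psi \_ `[0, +oo[; pose phi y := P y - P (- y).
have PE y : P y = if 0 <= y then psi y else 0.
  by rewrite /P patchE mem_setE in_itv /= andbT.
have mP : measurable_fun [set: R] P.
  by apply/(measurable_restrictT _ _).1 => //; apply: measurable_funTS; exact: continuous_measurable_fun.
have mphi : measurable_fun [set: R] phi by rewrite /phi; measurability.
have M0 : 0 <= M by exact: le_trans (bpsi 0 (lexx 0)).
have bP y : `|P y| <= M by rewrite PE; case: ifPn => [|_]; [exact: bpsi|rewrite normr0].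
have bphi y : `|phi y| <= M + M by rewrite (le_trans (ler_normB _ _))// lerD.
have iP : lebesgue_measure.-integrable [set: R] (EFin \o P).
  by have := (integrable_mkcond (mu := @lebesgue_measure R) _ (measurable_itv _)).1 ipsi; rewrite restrict_EFin.
have n10 : -1 != 0 :> R by rewrite oppr_eq0 oner_eq0.
have integrableN (f : R -> R) : lebesgue_measure.-integrable [set: R] (EFin \o f) ->
    lebesgue_measure.-integrable [set: R] (fun y => (f (- y))%:E).
  move=> intf; apply: (@integrable_affine _ (-1) 0 (fun y => f (- y)) n10).
    have mf : measurable_fun [set: R] f by apply/measurable_EFinP; exact: measurable_int intf.
    by measurability.
  by have := intf; apply: eq_integrable => // y _; rewrite /= mulN1r addr0 opprK.
have iphi : lebesgue_measure.-integrable [set: R] (EFin \o phi).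
  have := integrableB measurableT iP (integrableN _ iP).
  by apply: eq_integrable => // y _.
have cphi : phi x @[x --> h] --> phi h.
  (* The odd extension may jump at 0 only; [h] is positive, so [phi] coincides with [psi] around
     [h]. *)
  have near_h : {near h, psi =1 phi}.
    near=> y; rewrite /phi !PE oppr_ge0.
    have y0 : 0 < y by near: y; exact: lt_nbhsr.
    by rewrite ltW// leNgt y0/= subr0.
  have <- : psi h = phi h by exact: (nbhs_singleton near_h).
  by apply: cvg_trans (cpsi h); apply: near_eq_cvg.
have PhiE u : \int[lebesgue_measure]_y (phi y * cos ((y - h) * u)) = 2 * (m u * sin (h * u)).
  pose f y := phi y * cos ((y - h) * u).
  have intf : lebesgue_measure.-integrable [set: R] (EFin \o f).
    have := iphi; apply: le_integrable => //.
      by apply/measurable_EFinP; rewrite /f; measurability.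
    by move=> y _; rewrite lee_fin normrM ler_piMr// ler_norml cos_geN1 cos_le1.
  have mf : measurable_fun [set: R] f by apply/measurable_EFinP; exact: measurable_int intf.
  have [||_ ->] := integral_fold mf.
  - exact: integrableS intf.
  - exact: integrableS (integrableN _ intf).
  rewrite -psim.
  have cs : lebesgue_measure.-integrable `[0, +oo[ (fun y => (psi y * sin (y * u))%:E).
    have := ipsi; apply: le_integrable => //.
      apply/measurable_EFinP/measurable_funTS.
      have mpsi : measurable_fun [set: R] psi by exact: continuous_measurable_fun.
      by measurability.
    by move=> y _; rewrite lee_fin normrM ler_piMr// ler_norml sin_geN1 sin_le1.
  rewrite mulrC -mulrA -RintegralZr//.
  apply: eq_Rintegral => y; rewrite inE/= in_itv/= andbT => y0.
  have -> : f (- y) = - phi y * cos ((- y - h) * u) by rewrite /f /phi opprK opprB.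
  have -> : f y + - phi y * cos ((- y - h) * u) =
      phi y * (cos ((y - h) * u) - cos ((y + h) * u)).
    by rewrite /f -opprD (mulNr (y + h)) cosN; ring.
  have -> : cos ((y - h) * u) - cos ((y + h) * u) = sin (y * u) * (sin (h * u) * 2).
    by rewrite mulrBl mulrDl cosB cosD; ring.
  (* At 0 the extension vanishes whatever [psi 0] is, and the factor [sin (y * u)] hides the
     discrepancy. *)
  have [->|yn0] := eqVneq y 0; first by rewrite mul0r sin0 !(mul0r, mulr0).
  rewrite mulrA; congr (_ * _ * _).
  rewrite /phi !PE y0 oppr_ge0 leNgt lt_neqAle eq_sym yn0 y0/=.
  by rewrite subr0.
have iPhi : lebesgue_measure.-integrable [set: R] (fun u => (2 * (m u * sin (h * u)))%:E).
  have := integrableZl measurableT 2 im; apply: le_integrable => //.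
    have mm : measurable_fun [set: R] m by apply/measurable_EFinP; exact: measurable_int im.
    by apply/measurable_EFinP; measurability.
  move=> u _; rewrite lee_fin !normrM ler_wpM2l// ler_piMr//.
  by rewrite ler_norml sin_geN1 sin_le1.
have im' : lebesgue_measure.-integrable [set: R] (fun u => (m u * sin (h * u))%:E).
  have := integrableZl measurableT 2^-1 iPhi; apply: eq_integrable => // u _.
  by rewrite -EFinM mulKf.
have := Rintegral_cosine_inversion mphi bphi iphi cphi.
under eq_fun do rewrite PhiE.
move=> /(_ iPhi).
rewrite RintegralZl// -mulrA => /(mulfI (x := 2)) -> //.
by congr (_ * _); rewrite /phi !PE oppr_ge0 (ltW h0) leNgt h0 subr0.
Unshelve. all: end_near. Qed.

(** * Sine transforms *)

(** The transform comes with the regularity of [psi] that inversion uses. The bound concerns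
    [0 <= y] only, because the exponentials considered grow on the negative half-line. *)
Definition is_sine_transform (R : realType) (psi m : R -> R) : Prop :=
  exists M : R, [/\ continuous psi, (forall y, 0 <= y -> `|psi y| <= M),
    lebesgue_measure.-integrable `[0, +oo[ (EFin \o psi) &
    forall u, \int[lebesgue_measure]_(y in `[0, +oo[) (psi y * sin (y * u)) = m u].

Lemma sine_transform_ext (R : realType) (psi m n : R -> R) :
  m =1 n -> is_sine_transform psi m -> is_sine_transform psi n.
Proof. by move=> mn [M [? ? ? psim]]; exists M; split=> // u; rewrite psim mn. Qed.

(** The product of sines is half a difference of cosines of frequencies [b - u] and [b + u], so the
    transform is a difference of two Lorentzians. *)
Lemma sine_transform_damped_sine (R : realType) (a b : R) : 0 < a ->
  is_sine_transform (fun y => expR (- (a * y)) * sin (b * y))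
    (fun u => 2 * a * b * u / ((a ^+ 2 + (b - u) ^+ 2) * (a ^+ 2 + (b + u) ^+ 2))).
Proof.
move=> a0; exists 1; split.
- by derivable_continuous.
- move=> y y0; rewrite normrM ger0_norm ?expR_ge0// mulr_ile1 ?expR_ge0//.
    by rewrite -[leRHS]expR0 ler_expR oppr_le0 mulr_ge0// ltW.
  by rewrite ler_norml sin_geN1 sin_le1.
- have [+ _] := integral0y_expR_cos_sin b 0 1 a0; apply: eq_integrable => // y _.
  by rewrite mul0r add0r mul1r.
- move=> u.
  have [i1 I1] := integral0y_expR_cos_sin (b - u) 2^-1 0 a0.
  have [i2 I2] := integral0y_expR_cos_sin (b + u) 2^-1 0 a0.
  have D0 (x : R) : a ^+ 2 + x ^+ 2 != 0 by rewrite gt_eqF// ltr_wpDr ?sqr_ge0// exprn_gt0.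
  transitivity (a * 2^-1 / (a ^+ 2 + (b - u) ^+ 2) - a * 2^-1 / (a ^+ 2 + (b + u) ^+ 2)).
    have := RintegralB (mu := @lebesgue_measure R) (measurable_itv _) i1 i2; rewrite I1 I2 !mulr0 !addr0 => <-.
    apply: eq_Rintegral => y _; rewrite !mul0r !addr0 mulrBl mulrDl cosB cosD (mulrC y u).
    by field.
  by field; rewrite !D0.
Qed.

(** One exponential alone has the transform $u/(a^2+u^2)$, which is not integrable; in the
    difference the leading terms cancel and the decay is at least cubic. *)
Lemma sine_transform_expR_diff (R : realType) (a b : R) : 0 < a -> 0 < b ->
  is_sine_transform (fun y => expR (- (a * y)) - expR (- (b * y)))
    (fun u => u / (a ^+ 2 + u ^+ 2) - u / (b ^+ 2 + u ^+ 2)).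
Proof.
move=> a0 b0; exists (1 + 1); split.
- by derivable_continuous.
- move=> y y0; rewrite (le_trans (ler_normB _ _))// lerD//.
    by rewrite ger0_norm ?expR_ge0// -[leRHS]expR0 ler_expR oppr_le0 mulr_ge0// ltW.
  by rewrite ger0_norm ?expR_ge0// -[leRHS]expR0 ler_expR oppr_le0 mulr_ge0// ltW.
- have := integrableB (mu := @lebesgue_measure R) (measurable_itv _) (integral0y_expRM a0) (integral0y_expRM b0).
  by apply: eq_integrable.
- move=> u; have [ia Ia] := integral0y_expR_cos_sin u 0 1 a0.
  have [ib Ib] := integral0y_expR_cos_sin u 0 1 b0.
  have := RintegralB (mu := @lebesgue_measure R) (measurable_itv _) ia ib; rewrite Ia Ib !mulr0 !add0r !mulr1 => <-.
  by apply: eq_Rintegral => y _; rewrite !mul0r !add0r !mul1r (mulrC y u); ring.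
Qed.

Lemma sine_transform_mul_expR (R : realType) :
  is_sine_transform (fun y : R => y * expR (- y)) (fun u => 2 * u / (1 + u ^+ 2) ^+ 2).
Proof.
pose g (y : R) := y * expR (- y).
pose G (y : R) := - ((y + 1) * expR (- y)).
have cg : continuous g by derivable_continuous.
have dG (y : R) : is_derive y 1 G (g y).
  by rewrite /G; apply: is_derive_eq; rewrite /GRing.scale /= /g; ring.
(* Half of the exponential absorbs the linear factor, since $1+y\le 2(1+y/2)\le 2e^{y/2}$. This
   yields the limits at infinity as well as the bound 2 on the function. *)
have bound (y : R) : 0 <= y -> (y + 1) * expR (- y) <= 2 * expR (- (2^-1 * y)).
  move=> y0; have -> : - y = - (2^-1 * y) + - (2^-1 * y) by field.
  rewrite expRD mulrA ler_pM2r ?expR_gt0//.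
  rewrite expRN ler_pdivrMr ?expR_gt0//.
  have := expR_ge1Dx (2^-1 * y); lra.
have lim0 : (y + 1) * expR (- y) @[y --> +oo] --> (0 : R).
  apply: (@cvgr0_le_norm _ _ (fun y => 2 * expR (- (2^-1 * y)))).
    by move=> y y0; rewrite ger0_norm ?bound// mulr_ge0 ?expR_ge0// addr_ge0.
  by rewrite -[X in _ --> X](mulr0 2); apply: cvgM; [exact: cvg_cst|exact: cvgr_expRM].
have G0 : G y @[y --> +oo] --> - (0 : R) by exact: cvgN.
have FTC (u : R) : lebesgue_measure.-integrable `[0, +oo[ (EFin \o g) /\
    \int[lebesgue_measure]_(y in `[0, +oo[) (g y * sin (y * u)) = 2 * u / (1 + u ^+ 2) ^+ 2.
  have N0 : 1 + u ^+ 2 != 0 by rewrite gt_eqF// ltr_pwDl// sqr_ge0.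
  (* The affine coefficients solve $p-p'-uq=0$ and $q-q'+up=y$, the conditions for [F] to be a
     primitive of [f]. *)
  pose p (y : R) := u / (1 + u ^+ 2) * y + 2 * u / (1 + u ^+ 2) ^+ 2.
  pose q (y : R) := (1 + u ^+ 2)^-1 * y + (1 - u ^+ 2) / (1 + u ^+ 2) ^+ 2.
  pose F (y : R) := - (expR (- y) * (p y * cos (y * u) + q y * sin (y * u))).
  pose f (y : R) := g y * sin (y * u).
  have cf : continuous f by rewrite /f /g; derivable_continuous.
  have dF (y : R) : is_derive y 1 F (f y).
    by rewrite /F /p /q; apply: is_derive_eq; rewrite /GRing.scale /= /f /g; field.
  have fg y : 0 <= y -> `|f y| <= g y.
    move=> y0; rewrite /f normrM; have gy : 0 <= g y by rewrite mulr_ge0// expR_ge0.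
    by rewrite (ger0_norm gy) ler_piMr// ler_norml sin_geN1 sin_le1.
  have F0 : F y @[y --> +oo] --> (0 : R).
    pose K := `|u / (1 + u ^+ 2)| + `|2 * u / (1 + u ^+ 2) ^+ 2| +
      (`|(1 + u ^+ 2)^-1| + `|(1 - u ^+ 2) / (1 + u ^+ 2) ^+ 2|).
    have lin (c d y : R) : 0 <= y -> `|c * y + d| <= (`|c| + `|d|) * (y + 1).
      move=> y0; rewrite (le_trans (ler_normD _ _))// normrM (ger0_norm y0).
      have := mulr_ge0 (normr_ge0 d) y0; have := normr_ge0 c; lra.
    apply: (@cvgr0_le_norm _ _ (fun y => K * ((y + 1) * expR (- y)))).
      move=> y y0; rewrite normrN normrM ger0_norm ?expR_ge0// mulrA mulrC.
      rewrite ler_wpM2r ?expR_ge0// (le_trans (ler_normD _ _))// /K [leRHS]mulrDl lerD//.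
        rewrite normrM (le_trans _ (lin _ _ _ y0))// ler_piMr//.
        by rewrite ler_norml cos_geN1 cos_le1.
      rewrite normrM (le_trans _ (lin _ _ _ y0))// ler_piMr//.
      by rewrite ler_norml sin_geN1 sin_le1.
    by rewrite -[X in _ --> X](mulr0 K); apply: cvgM; [exact: cvg_cst|exact: lim0].
  have gg y : 0 <= y -> `|g y| <= g y.
    by move=> y0; rewrite ger0_norm// mulr_ge0// expR_ge0.
  split; first exact: (integral0y_dominated cg cg gg dG dG G0 G0).1.
  rewrite [LHS](integral0y_dominated cf cg fg dF dG F0 G0).2.
  by rewrite /F /p /q oppr0 expR0 mul0r cos0 sin0 !mulr0 add0r; ring.
exists 2; split=> [//|y y0||u]; [|exact: (FTC 0).1|exact: (FTC u).2].
rewrite ger0_norm; last by rewrite mulr_ge0// expR_ge0.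
apply: (@le_trans _ _ ((y + 1) * expR (- y))); first by rewrite ler_wpM2r ?expR_ge0// lerDl.
rewrite (le_trans (bound _ y0))// ler_piMr// -[leRHS]expR0 ler_expR oppr_le0.
by rewrite mulr_ge0// invr_ge0.
Qed.

Lemma sine_transformZ (R : realType) (c : R) (psi m : R -> R) :
  is_sine_transform psi m -> is_sine_transform (fun y => c * psi y) (fun u => c * m u).
Proof.
move=> [M [cpsi bpsi ipsi psim]]; exists (`|c| * M); split.
- by move=> y; apply: cvgM; [exact: cvg_cst|exact: cpsi].
- by move=> y y0; rewrite normrM ler_wpM2l// bpsi.
- exact: (integrableZl (mu := @lebesgue_measure R) (measurable_itv _) c ipsi).
- move=> u; rewrite -psim -RintegralZl//.
    by apply: eq_Rintegral => y _; rewrite mulrA.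
  have := ipsi; apply: le_integrable => //.
    apply/measurable_EFinP/measurable_funTS.
    have mpsi : measurable_fun [set: R] psi by exact: continuous_measurable_fun.
    by measurability.
  by move=> y _; rewrite lee_fin normrM ler_piMr// ler_norml sin_geN1 sin_le1.
Qed.

(** The function [psi] is given by a closed form continuous on the whole line, while [W3] divides by
    [h]; hence their relation is stated for positive [h] only. *)
Lemma ssrf_sine_transform (R : realType) (eta1 : R) : -2 < eta1 ->
  exists psi : R -> R,
    is_sine_transform psi (fun u => u / (1 + eta1 * u ^+ 2 + u ^+ 4)) /\
    (forall h, 0 < h -> psi h = 2 * h * W3 h eta1).
Proof.
move=> e2; rewrite /W3; have [elt|ege] := boolP (`|eta1| < 2).
  set a := ssrf_beta2 eta1; set b := ssrf_beta1 eta1.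
  move: (elt); rewrite ltr_norml => /andP[_ elt2].
  have p0 : 0 < 2 + eta1 by lra.
  have m0 : 0 < 2 - eta1 by lra.
  have a0 : 0 < a by rewrite divr_gt0// sqrtr_gt0 gtr0_norm.
  have b0 : 0 < b by rewrite divr_gt0// sqrtr_gt0 gtr0_norm.
  have a2 : 4 * a ^+ 2 = 2 + eta1.
    rewrite /a /ssrf_beta2 gtr0_norm// -[RHS](sqr_sqrtr (ltW p0)); by field.
  have b2 : 4 * b ^+ 2 = 2 - eta1.
    by rewrite /b /ssrf_beta1 gtr0_norm// -[RHS](sqr_sqrtr (ltW m0)); field.
  have DE : ssrf_Delta eta1 = 4 * a * b.
    transitivity (Num.sqrt ((4 * a * b) ^+ 2)); last first.
      by rewrite sqrtr_sqr ger0_norm// mulr_ge0 ?mulr_ge0// ltW.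
    rewrite /ssrf_Delta; congr Num.sqrt.
    have -> : (4 * a * b) ^+ 2 = (4 * a ^+ 2) * (4 * b ^+ 2) by ring.
    rewrite a2 b2 ler0_norm; first by ring.
    have := mulr_gt0 p0 m0; nra.
  have an0 : a != 0 by rewrite gt_eqF.
  have bn0 : b != 0 by rewrite gt_eqF.
  exists (fun y => (2 * a * b)^-1 * (expR (- (a * y)) * sin (b * y))); split.
    apply: sine_transform_ext (sine_transformZ (2 * a * b)^-1 (sine_transform_damped_sine b a0)) => u /=.
    have sq (x : R) : a ^+ 2 + x ^+ 2 != 0 by rewrite gt_eqF// ltr_wpDr ?sqr_ge0// exprn_gt0.
    (* Here $a=\beta_2$ and $b=\beta_1$ satisfy $a^2+b^2=1$ and $2(a^2-b^2)=\eta_1$, so the roots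
       are $\pm b\pm ia$. *)
    have -> : 1 + eta1 * u ^+ 2 + u ^+ 4 = (a ^+ 2 + (b - u) ^+ 2) * (a ^+ 2 + (b + u) ^+ 2).
      have -> : eta1 = 2 * a ^+ 2 - 2 * b ^+ 2 by lra.
      have ab1 : 1 = (a ^+ 2 + b ^+ 2) ^+ 2.
        have -> : a ^+ 2 + b ^+ 2 = 1 by lra.
        by rewrite expr1n.
      rewrite {1}ab1; ring.
    by field; rewrite !sq an0 bn0.
  move=> h h0; rewrite DE (mulrC h a) (mulrC h b); field.
  by rewrite bn0 an0 gt_eqF.
have ege2 : 2 <= eta1.
  by move: ege; rewrite -leNgt ler_normr => /orP[//|]; rewrite lerNr leNgt e2.
have [->|en2] := eqVneq eta1 2.
  exists (fun y => 2^-1 * (y * expR (- y))); split.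
    apply: sine_transform_ext (sine_transformZ 2^-1 (@sine_transform_mul_expR R)) => u /=.
    have N0 : 1 + u ^+ 2 != 0 by rewrite gt_eqF// ltr_pwDl// sqr_ge0.
    have -> : 1 + 2 * u ^+ 2 + u ^+ 4 = (1 + u ^+ 2) ^+ 2 by ring.
    by field.
  by move=> h h0; field.
have egt : 2 < eta1 by rewrite lt_neqAle eq_sym en2.
have d2 : 0 < eta1 ^+ 2 - 4 by nra.
set d := ssrf_Delta eta1.
have d0 : 0 < d by rewrite sqrtr_gt0 gtr0_norm.
have dE : d ^+ 2 = eta1 ^+ 2 - 4 by rewrite /d /ssrf_Delta gtr0_norm// sqr_sqrtr// ltW.
have dlt : d < eta1 by nra.
have w10 : 0 < (eta1 - d) / 2 by rewrite divr_gt0// subr_gt0.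
have w20 : 0 < (eta1 + d) / 2 by rewrite divr_gt0// addr_gt0//; lra.
set a := ssrf_omega1 eta1; set b := ssrf_omega2 eta1.
have aE : a ^+ 2 = (eta1 - d) / 2.
  by rewrite /a /ssrf_omega1 -/d gtr0_norm ?subr_gt0// sqr_sqrtr// ltW.
have bE : b ^+ 2 = (eta1 + d) / 2.
  by rewrite /b /ssrf_omega2 -/d gtr0_norm ?addr_gt0//; [rewrite sqr_sqrtr// ltW|lra].
have a0 : 0 < a by rewrite sqrtr_gt0 -/d gtr0_norm ?subr_gt0.
have b0 : 0 < b by rewrite sqrtr_gt0 -/d gtr0_norm ?addr_gt0//; lra.
have dn0 : d != 0 by rewrite gt_eqF.
exists (fun y => d^-1 * (expR (- (a * y)) - expR (- (b * y)))); split.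
  apply: sine_transform_ext (sine_transformZ d^-1 (sine_transform_expR_diff a0 b0)) => u /=.
  have sq (c x : R) : 0 < c -> c ^+ 2 + x ^+ 2 != 0.
    by move=> c0; rewrite gt_eqF// ltr_wpDr ?sqr_ge0// exprn_gt0.
  (* Here $a^2=\omega_1^2$ and $b^2=\omega_2^2$ have sum $\eta_1$, product 1 and difference
     $b^2-a^2=\Delta$. *)
  have -> : 1 + eta1 * u ^+ 2 + u ^+ 4 = (a ^+ 2 + u ^+ 2) * (b ^+ 2 + u ^+ 2).
    have ab : 1 = a ^+ 2 * b ^+ 2.
      rewrite aE bE; have -> : (eta1 - d) / 2 * ((eta1 + d) / 2) = (eta1 ^+ 2 - d ^+ 2) / 4 by field.
      by rewrite dE; field.
    have ab' : eta1 = a ^+ 2 + b ^+ 2 by rewrite aE bE; field.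
    rewrite {1}ab ab'; ring.
  have dab : d = b ^+ 2 - a ^+ 2 by rewrite aE bE; field.
  have dabn0 : b ^+ 2 - a ^+ 2 != 0 by rewrite -dab.
  by rewrite dab; field; rewrite !sq.
by move=> h h0; rewrite (mulrC h a) (mulrC h b); field; rewrite dn0 gt_eqF.
Qed.

(** * The radial integral *)

Lemma ssrf_den_ge (R : realType) (eta1 : R) : -2 < eta1 ->
  exists2 c : R, 0 < c & forall q, 0 <= q -> c * (1 + q ^+ 2) <= 1 + eta1 * q + q ^+ 2.
Proof.
move=> e2; have [e0|e0] := leP 0 eta1.
  exists 1 => // q q0; have := mulr_ge0 e0 q0; lra.
(* With this constant the difference of the two sides is exactly $-\frac{\eta_1}{2}(1-q)^2$,
   nonnegative for negative $\eta_1$. *)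
exists ((2 + eta1) / 2); first by rewrite divr_gt0//; lra.
move=> q q0; have : 0 <= - eta1 / 2 * (1 - q) ^+ 2.
  by rewrite mulr_ge0 ?sqr_ge0//; lra.
nra.
Qed.

Lemma ssrf_den_gt0 (R : realType) (eta1 q : R) : -2 < eta1 -> 0 <= q ->
  0 < 1 + eta1 * q + q ^+ 2.
Proof.
move=> e2 q0; have [c c0 cD] := ssrf_den_ge e2.
by apply: lt_le_trans (cD q q0); rewrite mulr_gt0// ltr_pwDl ?sqr_ge0.
Qed.

(** With [|q|] in place of [q] the denominator is positive on the whole line, so its inverse is
    continuous there. *)
Lemma measurable_ssrf_den (R : realType) (eta1 : R) : -2 < eta1 ->
  measurable_fun [set: R] (fun q => (1 + eta1 * `|q| + `|q| ^+ 2)^-1).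
Proof.
have cn2 : continuous (fun x : R => `|x| ^+ 2).
  move=> x; apply: (@continuous_comp _ _ _ (fun x : R => `|x|) (fun x => x ^+ 2)).
    exact: norm_continuous.
  exact: exprn_continuous.
move=> e2; apply: continuous_measurable_fun => q; apply: cvgV.
  by rewrite gt_eqF// ssrf_den_gt0.
apply: cvgD; [apply: cvgD; [exact: cvg_cst|apply: cvgM; [exact: cvg_cst|exact: norm_continuous]]|].
exact: cn2.
Qed.

(** The growth condition on [g], with the lower bound on the denominator, dominates the quotient by
    a multiple of $1/(1+v^2)$. It is met by $v$ and by $v^2$. *)
Lemma integrable_ssrf_den (R : realType) (eta1 : R) (g : R -> R) : -2 < eta1 ->
  measurable_fun [set: R] g -> (forall v, `|g v| * (1 + v ^+ 2) <= 2 * (1 + v ^+ 4)) ->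
  lebesgue_measure.-integrable [set: R] (fun v => (g v / (1 + eta1 * v ^+ 2 + v ^+ 4))%:E).
Proof.
move=> e2 mg gle; have [c c0 cD] := ssrf_den_ge e2.
have mh : measurable_fun [set: R] (fun v => g v / (1 + eta1 * v ^+ 2 + v ^+ 4)).
  have mD := measurable_ssrf_den e2.
  have -> : (fun v => g v / (1 + eta1 * v ^+ 2 + v ^+ 4)) =
      (fun v => g v * (fun q => (1 + eta1 * `|q| + `|q| ^+ 2)^-1) (v ^+ 2)).
    by apply/funext => v; rewrite ger0_norm ?sqr_ge0// -exprM.
  apply: measurable_funM => //.
  by apply: (measurableT_comp mD); exact: measurable_funX.
have := integrableZl measurableT (2 / c) (@integrable_cosatan_sqr R).
apply: le_integrable => //; first exact/measurable_EFinP.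
move=> v _; rewrite lee_fin.
have D0 : 0 < 1 + eta1 * v ^+ 2 + v ^+ 4.
  by rewrite (_ : v ^+ 4 = (v ^+ 2) ^+ 2) ?ssrf_den_gt0 ?sqr_ge0// -exprM.
have v0 : 0 < 1 + v ^+ 2 by rewrite ltr_pwDl// sqr_ge0.
have Di : 0 < (1 + eta1 * v ^+ 2 + v ^+ 4)^-1 by rewrite invr_gt0.
have c20 : 0 <= 2 / c * cosatan v ^+ 2 by rewrite mulr_ge0 ?sqr_ge0// divr_ge0// ltW.
rewrite [X in _ <= X](ger0_norm c20) normrM (gtr0_norm Di) cosatan_sqr.
rewrite ler_pdivrMr// mulrAC ler_pdivlMr// (le_trans (gle v))//.
have -> : 2 * (1 + v ^+ 4) = 2 / c * (c * (1 + v ^+ 4)) by field; rewrite gt_eqF.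
rewrite ler_wpM2l ?divr_ge0 ?(ltW c0)//.
by have := cD (v ^+ 2) (sqr_ge0 v); rewrite -exprM.
Qed.

Lemma dot3_ge0 (R : realType) (k : R * R * R) : 0 <= dot3 k k.
Proof. by rewrite /dot3 -!expr2 !addr_ge0// sqr_ge0. Qed.

Lemma ge0_Rintegral_of_integral d (T : measurableType d) (R : realType)
    (mu : {measure set T -> \bar R}) (f : T -> R) (x : R) : measurable_fun setT f ->
  (forall t, 0 <= f t) -> (\int[mu]_t (f t)%:E = x%:E)%E ->
  mu.-integrable setT (EFin \o f) /\ \int[mu]_t f t = x.
Proof.
move=> mf f0 fx; split; last by rewrite /Rintegral fx.
apply/integrableP; split; first exact/measurable_EFinP.
under eq_integral => t _ do rewrite gee0_abs ?lee_fin//.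
by rewrite fx ltry.
Qed.

Section radial_integral.
Context {R : realType}.
Variables (eta1 c xi : R) (r : R * R * R).
Hypotheses (eta1_gt : -2 < eta1) (c0 : 0 <= c) (xi0 : 0 < xi) (r0 : 0 < norm3 r).

(** The spectral density as a function of the squared wave number, with [c] standing for
    [eta0 * xi ^+ 3]. *)
Let f (q : R) := c * (1 + eta1 * `|q * xi ^+ 2| + `|q * xi ^+ 2| ^+ 2)^-1.
Let m (v : R) := v / (1 + eta1 * v ^+ 2 + v ^+ 4).

Let f0 q : 0 <= f q.
Proof. by rewrite mulr_ge0// invr_ge0 ltW// ssrf_den_gt0. Qed.

Let mf : measurable_fun [set: R] f.
Proof.
apply: measurable_funM; first exact: measurable_cst.
apply: (measurableT_comp (measurable_ssrf_den eta1_gt)).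
exact: measurable_funM.
Qed.

Let fm w : w * f (w ^+ 2) = c / xi * m (xi * w).
Proof.
rewrite /f /m -exprMn ger0_norm ?sqr_ge0// -exprM (mulrC w xi).
have D0 : 1 + eta1 * (xi * w) ^+ 2 + (xi * w) ^+ 4 != 0.
  rewrite (_ : (xi * w) ^+ 4 = ((xi * w) ^+ 2) ^+ 2); last by rewrite -exprM.
  by rewrite gt_eqF// ssrf_den_gt0// sqr_ge0.
by field; rewrite D0 gt_eqF.
Qed.

Let im : lebesgue_measure.-integrable [set: R] (EFin \o m).
Proof.
apply: integrable_ssrf_den => // v.
have := sqr_ge0 (`|v| - 1); have := sqr_ge0 (v ^+ 2 - 1).
rewrite -(real_normK (num_real v)).
have -> : v ^+ 4 = `|v| ^+ 4 by rewrite -[RHS]normrX ger0_norm// (_ : 4%N = 2 * 2)%N// exprM sqr_ge0.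
move: (normr_ge0 v) => n0; move: `|v| n0 => x x0 *.
(* Expanded, this reads $2x^3+2x\le x^4+2x^2+1$; together with $2x^2\le x^4+1$ it gives $x+x^3\le
   1+x^4$. *)
have : 0 <= (x - 1) ^+ 2 * (1 + x ^+ 2) by rewrite mulr_ge0 ?sqr_ge0// addr_ge0// sqr_ge0.
nra.
Qed.

Let im2 : lebesgue_measure.-integrable [set: R] (fun v => (v * m v)%:E).
Proof.
have : lebesgue_measure.-integrable [set: R]
    (fun v => (v ^+ 2 / (1 + eta1 * v ^+ 2 + v ^+ 4))%:E).
  apply: integrable_ssrf_den => //.
  move=> v; rewrite ger0_norm ?sqr_ge0//; have := sqr_ge0 (v ^+ 2 - 1).
  by rewrite (_ : v ^+ 4 = (v ^+ 2) ^+ 2) -?exprM//; nra.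
by apply: eq_integrable => // v _; rewrite /m mulrA expr2.
Qed.

Lemma measurable_dot3 (g : R -> R) (s : R * R * R) : measurable_fun [set: R] g ->
  measurable_fun setT (fun k : R * R * R => g (dot3 k s) * f (dot3 k k)).
Proof.
move=> mg; apply: measurable_funM.
  by apply: (measurableT_comp mg); rewrite /dot3; measurability.
by apply: (measurableT_comp mf); rewrite /dot3; measurability.
Qed.

Let ixi (g : R -> R) : lebesgue_measure.-integrable [set: R] (EFin \o g) ->
  lebesgue_measure.-integrable [set: R] (fun w => (g (xi * w))%:E).
Proof.
move=> ig; apply: (@integrable_affine _ xi^-1 0 (fun w => g (xi * w))).
- by rewrite invr_eq0 gt_eqF.
- have mg : measurable_fun [set: R] g by apply/measurable_EFinP; exact: measurable_int ig.
  by measurability.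
- have := ig; apply: eq_integrable => // w _ /=; congr (g _)%:E.
  by field; rewrite gt_eqF.
Qed.

(** The value depends on [s] through its norm alone. This generality serves to compare [r] with its
    opposite in the sine integral. *)
Let radial_integral (s : R * R * R) (C S : R -> R) : norm3 s = norm3 r ->
  (forall x, 0 <= C x) -> continuous C -> (forall x : R, is_derive x 1 S (C x)) ->
  lebesgue_measure.-integrable [set: R]
    (fun w => (w * f (w ^+ 2) * (S (norm3 r * w) - S 0))%:E) ->
  (@lebesgue3 R).-integrable setT (fun k => (C (dot3 k s) * f (dot3 k k))%:E) /\
  \int[@lebesgue3 R]_k (C (dot3 k s) * f (dot3 k k)) =
    2 * pi / norm3 r * \int[lebesgue_measure]_w (w * f (w ^+ 2) * (S (norm3 r * w) - S 0)).
Proof.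
move=> sr C0 cC dS iS.
have mC : measurable_fun [set: R] C by exact: continuous_measurable_fun.
apply: ge0_Rintegral_of_integral.
- exact: measurable_dot3.
- by move=> k; rewrite mulr_ge0.
- rewrite (@ge0_integral_radial3 _ s C S f) ?sr//.
  under eq_integral do rewrite EFinM.
  rewrite integralZl//.
  by rewrite /Rintegral [RHS]EFinM fineK// integrable_fin_num.
Qed.

Let i_id : lebesgue_measure.-integrable [set: R]
    (fun w => (w * f (w ^+ 2) * (norm3 r * w - 0))%:E).
Proof.
have := integrableZl measurableT (c / xi ^+ 2 * norm3 r) (ixi im2).
apply: eq_integrable => // w _; rewrite /= -EFinM fm subr0; congr (_%:E).
by field; rewrite gt_eqF.
Qed.

Let i_bounded (g : R -> R) : continuous g -> (forall x, `|g x| <= 1) ->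
  lebesgue_measure.-integrable [set: R]
    (fun w => (w * f (w ^+ 2) * g (norm3 r * w))%:E).
Proof.
move=> cg g1.
have mg : measurable_fun [set: R] g by exact: continuous_measurable_fun.
have iw : lebesgue_measure.-integrable [set: R] (fun w => (w * f (w ^+ 2))%:E).
  have := integrableZl measurableT (c / xi) (ixi im).
  by apply: eq_integrable => // w _; rewrite /= -EFinM fm.
have mw : measurable_fun [set: R] (fun w => w * f (w ^+ 2)).
  by apply/measurable_EFinP; exact: measurable_int iw.
have := iw; apply: le_integrable => //; first by apply/measurable_EFinP; measurability.
by move=> w _; rewrite lee_fin normrM ler_piMr.
Qed.

Lemma integrable_radial3 :
  (@lebesgue3 R).-integrable setT (fun k => (f (dot3 k k))%:E).
Proof.
have [+ _] := @radial_integral r (fun=> 1) id erefl (fun=> ler01) (@cst_continuous _ _ _)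
  (fun x => is_derive_id _ _) i_id.
by apply: eq_integrable => // k _; rewrite mul1r.
Qed.

Let i_dot3 (g : R -> R) (s : R * R * R) : continuous g -> (forall x, `|g x| <= 1) ->
  (@lebesgue3 R).-integrable setT (fun k => (g (dot3 k s) * f (dot3 k k))%:E).
Proof.
move=> cg g1; have := integrable_radial3; apply: le_integrable => //.
  by apply/measurable_EFinP; apply: measurable_dot3; exact: continuous_measurable_fun.
by move=> k _; rewrite lee_fin normrM ler_piMl.
Qed.

(** The primitives of [1 + cos] and of 1 differ by [sin], so subtraction leaves the integral of
    [w * f (w ^+ 2) * sin (norm3 r * w)]. The scaling [v = xi * w] turns it into the inversion
    integral at [norm3 r / xi]. *)
Lemma Rintegral_radial3_cos (psi : R -> R) : is_sine_transform psi m ->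
  \int[@lebesgue3 R]_k (cos (dot3 k r) * f (dot3 k k)) =
    2 * pi ^+ 2 * c / (norm3 r * xi ^+ 2) * psi (norm3 r / xi).
Proof.
move=> [M [cpsi bpsi ipsi psim]].
have cos1 x : `|cos x| <= 1 :> R by rewrite ler_norml cos_geN1 cos_le1.
have sin1 x : `|sin x| <= 1 :> R by rewrite ler_norml sin_geN1 sin_le1.
have isin := i_bounded (@continuous_sin R) sin1.
have [_ I1] := @radial_integral r (fun=> 1) id erefl (fun=> ler01) (@cst_continuous _ _ _)
  (fun x => is_derive_id _ _) i_id.
have C0 (x : R) : 0 <= 1 + cos x by have := cos_geN1 x; lra.
have cC : continuous (fun x : R => 1 + cos x) by derivable_continuous.
have dS (x : R) : is_derive x 1 (fun x => x + sin x) (1 + cos x).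
  by apply: is_derive_eq.
have iS : lebesgue_measure.-integrable [set: R]
    (fun w => (w * f (w ^+ 2) * ((norm3 r * w + sin (norm3 r * w)) - (0 + sin 0)))%:E).
  have := integrableD measurableT i_id isin; apply: eq_integrable => // w _.
  by rewrite /= -EFinD sin0; congr (_%:E); ring.
have [iC IC] := @radial_integral r _ _ erefl C0 cC dS iS.
have icos := i_dot3 r (@continuous_cos R) cos1.
transitivity (\int[@lebesgue3 R]_k ((1 + cos (dot3 k r)) * f (dot3 k k)) -
    \int[@lebesgue3 R]_k (1 * f (dot3 k k))).
  rewrite -RintegralB//; first by apply: eq_Rintegral => k _; ring.
  by have := integrable_radial3; apply: eq_integrable => // k _; rewrite /= mul1r.
rewrite IC I1 -mulrBr -RintegralB//.
transitivity (2 * pi / norm3 r * \int[lebesgue_measure]_w (c / xi * (m (xi * w) * sin (norm3 r / xi * (xi * w))))).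
  congr (_ * _); apply: eq_Rintegral => w _; rewrite mulrA -fm sin0.
  have -> : norm3 r / xi * (xi * w) = norm3 r * w by field; rewrite gt_eqF.
  by ring.
have h0 : 0 < norm3 r / xi by rewrite divr_gt0.
have ims : lebesgue_measure.-integrable [set: R] (fun v => (m v * sin (norm3 r / xi * v))%:E).
  have mm : measurable_fun [set: R] m by apply/measurable_EFinP; exact: measurable_int im.
  have := im; apply: le_integrable => //; first by apply/measurable_EFinP; measurability.
  by move=> v _; rewrite lee_fin normrM ler_piMr.
rewrite RintegralZl//; last exact: (ixi ims).
have xi0' : xi != 0 by rewrite gt_eqF.
have Ev := Rintegral_affine 0 xi0' ims.
rewrite (Rintegral_sine_inversion h0 cpsi bpsi ipsi psim im) gtr0_norm// in Ev.
have -> : \int[lebesgue_measure]_w (m (xi * w) * sin (norm3 r / xi * (xi * w))) =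
    pi * psi (norm3 r / xi) / xi.
  rewrite Ev [RHS]mulrAC mulfV// mul1r; apply: eq_Rintegral => w _; by rewrite addr0.
by field; rewrite xi0' gt_eqF.
Qed.

(** The integral of [1 + sin] against the density is the same for [r] and for its opposite [nr], as
    they have equal norms; the difference of the two is twice the sine integral. *)
Lemma Rintegral_radial3_sin : \int[@lebesgue3 R]_k (sin (dot3 k r) * f (dot3 k k)) = 0.
Proof.
have cos1 x : `|cos x| <= 1 :> R by rewrite ler_norml cos_geN1 cos_le1.
have sin1 x : `|sin x| <= 1 :> R by rewrite ler_norml sin_geN1 sin_le1.
pose nr : R * R * R := (- r.1.1, - r.1.2, - r.2).
have dotN k : dot3 k nr = - dot3 k r by rewrite /dot3 /=; ring.
have normN : norm3 nr = norm3 r by rewrite /norm3; congr Num.sqrt; rewrite /dot3 /=; ring.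
have C0 (x : R) : 0 <= 1 + sin x by have := sin_geN1 x; lra.
have cC : continuous (fun x : R => 1 + sin x) by derivable_continuous.
have dS (x : R) : is_derive x 1 (fun x => x - cos x) (1 + sin x).
  by apply: is_derive_eq; rewrite opprK.
have icosw := i_bounded (@continuous_cos R) cos1.
have iw1 := i_bounded (@cst_continuous _ _ (1 : R)) (fun=> ltac:(by rewrite normr1)).
have iS : lebesgue_measure.-integrable [set: R]
    (fun w => (w * f (w ^+ 2) * ((norm3 r * w - cos (norm3 r * w)) - (0 - cos 0)))%:E).
  have := integrableD measurableT (integrableB measurableT i_id icosw) iw1.
  apply: eq_integrable => // w _; rewrite /= -EFinB -EFinD cos0; congr (_%:E); by ring.
have [i1 I1] := @radial_integral r _ _ erefl C0 cC dS iS.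
have [i2 I2] := @radial_integral nr _ _ normN C0 cC dS iS.
have isin := i_dot3 r (@continuous_sin R) sin1.
have : \int[@lebesgue3 R]_k (2 * (sin (dot3 k r) * f (dot3 k k))) = 0.
  transitivity (\int[@lebesgue3 R]_k ((1 + sin (dot3 k r)) * f (dot3 k k)) -
      \int[@lebesgue3 R]_k ((1 + sin (dot3 k nr)) * f (dot3 k k))).
    rewrite -RintegralB//; apply: eq_Rintegral => k _.
    by rewrite dotN sinN; ring.
  by rewrite I1 I2 subrr.
by rewrite RintegralZl// => /eqP; rewrite mulf_eq0 pnatr_eq0/= => /eqP.
Qed.

End radial_integral.

(** * The infinite-band limit *)

Lemma measurable_norm3 (R : realType) : measurable_fun setT (@norm3 R).
Proof.
apply: (@measurableT_comp _ _ _ _ _ _ (@Num.sqrt R)).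
  by apply: continuous_measurable_fun; exact: sqrt_continuous.
by rewrite /dot3; measurability.
Qed.

(** Each point lies in all large balls, so the truncations are eventually constant at every point,
    and [|F|] dominates them. The limit in [kc] is tested along sequences. *)
Lemma Rintegral_ball3_cvg (R : realType) (F : R * R * R -> R) :
  (@lebesgue3 R).-integrable setT (EFin \o F) ->
  \int[@lebesgue3 R]_(k in [set k | norm3 k <= kc]) F k @[kc --> +oo] -->
  \int[@lebesgue3 R]_k F k.
Proof.
move=> iF; apply/cvg_pinftyP => u uy.
have mB c : measurable [set k : R * R * R | norm3 k <= c].
  have := @measurable_norm3 R measurableT `]-oo, c]%classic (measurable_itv _).
  by rewrite setTI set_itvNyc.
have mF : measurable_fun setT F by apply/measurable_EFinP; exact: measurable_int iF.
under eq_cvg do rewrite Rintegral_mkcond.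
apply: (@Rintegral_dominated_cvg _ _ R (@lebesgue3 R)
  (fun n => F \_ [set k | norm3 k <= u n]) F (fun k => `|F k|)).
- move=> n; apply/(measurable_restrictT _ _).1; first exact: mB.
  by apply: measurable_funS mF => //; exact: subsetT.
- move=> k; apply: cvg_near_cst; near=> n.
  rewrite patchE mem_set//=; near: n.
  by have /cvgryPge := uy; apply.
- exact: integrable_norm iF.
- by move=> n k; rewrite patchE; case: ifPn => // _; rewrite normr0.
Unshelve. all: end_near. Qed.

Lemma cvg_complex (R : realType) (T : Type) (F : set_system T) (FF : Filter F)
    (a b : T -> R) (la lb : R) : a @ F --> la -> b @ F --> lb ->
  ((a x +i* b x : R[i]^o) @[x --> F] --> (la +i* lb : R[i]^o)).
Proof.
move=> ala blb; apply/cvgrPdist_lt => e e0.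
(* The tolerance [e] is itself complex; being positive for the order on complex numbers forces its
   imaginary part to vanish. *)
have [er0 eE] : 0 < complex.Re e /\ e = (complex.Re e)%:C.
  by move: e0; case: e => x y; rewrite ltcE /= => /andP[/eqP -> ->].
have e20 : 0 < complex.Re e / 2 by rewrite divr_gt0.
near=> x.
have ax : `|la - a x| < complex.Re e / 2 by near: x; exact: cvgr_dist_lt.
have bx : `|lb - b x| < complex.Re e / 2 by near: x; exact: cvgr_dist_lt.
rewrite eE normc_def ltcR /=.
apply: (@le_lt_trans _ _ (`|la - a x| + `|lb - b x|)); last by rewrite (splitr (complex.Re e)) ltrD.
have -> : `|la - a x| + `|lb - b x| = Num.sqrt ((`|la - a x| + `|lb - b x|) ^+ 2).
  by rewrite sqrtr_sqr [RHS]ger0_norm// addr_ge0.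
rewrite ler_wsqrtr//.
rewrite [in leRHS]sqrrD !real_normK ?num_real// [leRHS]addrAC lerDl.
by rewrite mulrn_wge0// mulr_ge0.
Unshelve. all: end_near. Qed.

Lemma spectral_densityE (R : realType) (eta0 eta1 xi : R) (k : R * R * R) :
  spectral_density eta0 eta1 xi k = eta0 * xi ^+ 3 *
    (1 + eta1 * `|dot3 k k * xi ^+ 2| + `|dot3 k k * xi ^+ 2| ^+ 2)^-1.
Proof.
rewrite ger0_norm; last by rewrite mulr_ge0 ?dot3_ge0 ?sqr_ge0.
have <- : (norm3 k * xi) ^+ 2 = dot3 k k * xi ^+ 2 by rewrite exprMn sqr_sqrtr ?dot3_ge0.
by rewrite -exprM.
Qed.

Lemma fgc_covariance_cvg (R : realType) (eta0 eta1 xi : R) (r : R * R * R) :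
  0 < eta0 -> 0 < xi -> -2 < eta1 -> 0 < norm3 r ->
  ((fgc_covariance eta0 eta1 xi kc r : R[i]^o) @[kc --> +oo] -->
     ((eta0 / (2 * pi) * W3 (norm3 r / xi) eta1)%:C : R[i]^o)).
Proof.
move=> eta00 xi0 eta1_gt r0.
have c0 : 0 <= eta0 * xi ^+ 3 by rewrite mulr_ge0 ?exprn_ge0// ltW.
have [psi [psiT psiW]] := ssrf_sine_transform eta1_gt.
have If := integrable_radial3 eta1_gt c0 xi0 r0.
have Ic := Rintegral_radial3_cos eta1_gt c0 xi0 r0 psiT.
have Is := Rintegral_radial3_sin eta1_gt c0 xi0 r0.
pose A (k : R * R * R) := cos (dot3 k r) * spectral_density eta0 eta1 xi k.
pose B (k : R * R * R) := sin (dot3 k r) * spectral_density eta0 eta1 xi k.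
have bounded_int (g : R -> R) : continuous g -> (forall x, `|g x| <= 1) ->
    (@lebesgue3 R).-integrable setT
      (fun k => (g (dot3 k r) * spectral_density eta0 eta1 xi k)%:E).
  move=> cg g1; under eq_fun do rewrite spectral_densityE.
  have := If; apply: le_integrable => //.
    apply/measurable_EFinP; apply: measurable_dot3 => //.
    exact: continuous_measurable_fun.
  by move=> k _; rewrite lee_fin normrM ler_piMl.
have iA : (@lebesgue3 R).-integrable setT (EFin \o A).
  by apply: bounded_int; [exact: continuous_cos|move=> x; rewrite ler_norml cos_geN1 cos_le1].
have iB : (@lebesgue3 R).-integrable setT (EFin \o B).
  by apply: bounded_int; [exact: continuous_sin|move=> x; rewrite ler_norml sin_geN1 sin_le1].
(* The factor $2\pi^2\eta_0\xi^3/(r\xi^2)$ of the cosine integral meets $\psi(h)=2hW_3$ with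
   $h=r/\xi$; dividing by $(2\pi)^3$ then leaves $\eta_0/(2\pi)$. *)
have EA : \int[@lebesgue3 R]_k A k = 4 * pi ^+ 2 * eta0 * W3 (norm3 r / xi) eta1.
  under eq_Rintegral do rewrite /A spectral_densityE.
  rewrite [LHS]Ic psiW ?divr_gt0//; field.
  by rewrite !gt_eqF.
have EB : \int[@lebesgue3 R]_k B k = 0.
  by under eq_Rintegral do rewrite /B spectral_densityE.
pose q : R := ((2 * pi) ^+ 3)^-1.
have fgcE kc : fgc_covariance eta0 eta1 xi kc r =
    (q * \int[@lebesgue3 R]_(k in [set k | norm3 k <= kc]) A k) +i*
    (q * \int[@lebesgue3 R]_(k in [set k | norm3 k <= kc]) B k).
  rewrite /fgc_covariance /Cintegral.
  have -> : (fun k => complex.Re (cexpi (dot3 k r) * (spectral_density eta0 eta1 xi k)%:C)) = A.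
    by apply/funext => k; rewrite /A /cexpi /= mulr0 subr0.
  have -> : (fun k => complex.Im (cexpi (dot3 k r) * (spectral_density eta0 eta1 xi k)%:C)) = B.
    by apply/funext => k; rewrite /B /cexpi /= mulr0 add0r.
  by apply/eqP; rewrite eq_complex /= !mul0r subr0 addr0 !eqxx.
under eq_fun do rewrite fgcE.
have -> : (eta0 / (2 * pi) * W3 (norm3 r / xi) eta1)%:C =
    (q * \int[@lebesgue3 R]_k A k) +i* (q * \int[@lebesgue3 R]_k B k).
  rewrite EB mulr0 EA; congr (_ +i* _); rewrite /q.
  have : pi != 0 :> R by rewrite gt_eqF// pi_gt0.
  by move: (@pi R) => p p0; field.
apply: cvg_complex; (apply: cvgM; first exact: cvg_cst); exact: Rintegral_ball3_cvg.
Qed.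

Theorem proposition4 (R : realType) (eta0 eta1 xi : R) (r : R * R * R)
    (eta0_gt0 : 0 < eta0) (xi_gt0 : 0 < xi) (eta1_gt : -2 < eta1)
    (r_gt0 : 0 < norm3 r) :
  ((fgc_covariance eta0 eta1 xi kc r : R[i]^o) @[kc --> +oo] -->
     ((eta0 / (2 * pi) * W3 (norm3 r / xi) eta1)%:C : R[i]^o)) /\
  (forall (d : R -> measure_display) (T : forall kc, measurableType (d kc))
      (P : forall kc, probability (T kc) R)
      (X : forall kc, R * R * R -> {RV (P kc) >-> R}),
    (forall kc, 0 < kc -> fgc_ssrf eta0 eta1 xi kc (X kc)) ->
    forall s : R * R * R,
      covariance (P kc) (X kc (s + r)) (X kc s) @[kc --> +oo] -->
        (eta0 / (2 * pi) * W3 (norm3 r / xi) eta1)%:E).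
Proof.
have G := fgc_covariance_cvg eta0_gt0 xi_gt0 eta1_gt r_gt0.
split=> // d T P X fgcX s.
(* The fields are constrained for positive [kc] only, so this identification holds near infinity.
   The covariance is real, hence equal to the real part of the Fourier integral. *)
have covE : \forall kc \near +oo,
    (complex.Re (fgc_covariance eta0 eta1 xi kc r))%:E =
    covariance (P kc) (X kc (s + r)) (X kc s).
  near=> kc; have kc0 : 0 < kc by near: kc; exact: nbhs_pinfty_gt.
  have [_ _ _ _ /(_ (s + r) s)[cfin cE]] := fgcX kc kc0.
  by rewrite -[RHS](fineK cfin); congr (_%:E); move: cE; rewrite [s + r]addrC addrK => <-.
apply: cvg_trans (near_eq_cvg covE) _.
apply: cvg_EFin; first exact: nearW.
move: G => /cvgrPdist_lt G; apply/cvgrPdist_lt => e e0.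
have eC0 : 0 < e%:C by rewrite ltcR.
near=> kc; rewrite -ltcR.
have : `|((eta0 / (2 * pi) * W3 (norm3 r / xi) eta1)%:C : R[i]^o) -
  fgc_covariance eta0 eta1 xi kc r| < e%:C by near: kc; exact: (G _ eC0).
(* The distance between real parts is at most the complex modulus of the difference. *)
apply: le_lt_trans; rewrite normc_def lecR /=.
rewrite -sqrtr_sqr ler_wsqrtr// lerDl sqr_ge0//.
Unshelve. all: end_near. Qed.
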